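(* Suppose $T_1,\dots,T_{n-1}$ are infinite subsets of $\mathbb{D}=\{2^s:s\in\mathbb{Z}\}$, $\Gamma$ is an infinite subset of $\mathbb{Z}$, $1\le p\le n-1$, and $1\le j_1<\dots<j_p\le n-1$. (a) Let $\mathcal{B}$ be the basis of all $n$-dimensional intervals $R_1\times\dots\times R_n$ such that $|R_1|\in T_1,\dots,|R_{n-1}|\in T_{n-1}$ and $|R_n|=2^\gamma/(|R_{j_1}|\cdots|R_{j_p}|)$ for some $\gamma\in\Gamma$. Then the maximal operator $M_{\mathcal{B}}$ associated to $\mathcal{B}$ satisfies the sharp weak type $L(1+\log^+L)^{n-1}$ estimate. (b) Under the same conditions, let $\mathcal{B}$ be the basis of all $n$-dimensional intervals $R_1\times\dots\times R_n$ such that $|R_1|\in T_1,\dots,|R_{n-1}|\in T_{n-1}$ and $|R_n|=2^\gamma|R_{j_1}|\cdots|R_{j_p}|$ for some $\gamma\in\Gamma$. Then the maximal operator $M_{\mathcal{B}}$ associated to $\mathcal{B}$ satisfies the sharp weak type $L(1+\log^+L)^{n-1}$ estimate.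
   Context: An interval in $\mathbb{R}^n$ is a rectangular parallelepiped (of positive finite measure) $R=R_1\times\dots\times R_n$ whose sides are parallel to the coordinate axes, where the $R_i$ are one-dimensional intervals. $|\cdot|$ denotes Lebesgue measure (length for one-dimensional intervals), $\log=\log_2$, and $\log^+u=\max(\log u,0)$ with $\log^+0=0$. For a nonempty translation invariant collection $\mathcal{B}$ of intervals in $\mathbb{R}^n$ the associated maximal operator is $$M_{\mathcal{B}}f(x)=\sup_{x\in R\in\mathcal{B}}\frac1{|R|}\int_R|f|$$ for measurable functions $f$ on $\mathbb{R}^n$. ''$M_{\mathcal{B}}$ satisfies the sharp weak type $L(1+\log^+L)^{n-1}$ estimate'' means: (i) there is a finite constant $C_n$ such that $|\{x\in\mathbb{R}^n: M_{\mathcal{B}}f(x)>\alpha\}|\le C_n\int_{\mathbb{R}^n}\frac{|f|}{\alpha}\big(1+\log^+\frac{|f|}{\alpha}\big)^{n-1}$ for all measurable functions $f$ and all $\alpha>0$; and (ii) this inequality is sharp in the sense that, if $\phi:[0,\infty)\to[0,\infty)$ is a convex increasing function with $\lim_{u\to\infty}\frac{\phi(u)}{u(1+\log u)^{n-1}}=0$, then there is no finite constant $C$ such that the estimate $|\{x\in\mathbb{R}^n: M_{\mathcal{B}}f(x)>\alpha\}|\le C\int_{\mathbb{R}^n}\phi\big(\frac{|f|}{\alpha}\big)$ holds for all measurable functions $f$ and all $\alpha>0$.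
   Formalization: In the sharpness clause (ii) the condition φ(0)=0 is added: if φ(0)>0, e.g. φ(u)=1+u, the integral of φ(|f|/α) over R^n is always infinite, so the estimate holds trivially with C=1 and the clause as stated is false. *)

(* Defs.v *)
From HB Require Import structures.
From mathcomp Require Import all_boot all_order all_algebra.
From mathcomp Require Import all_classical all_reals all_analysis.

Set Implicit Arguments.
Unset Strict Implicit.
Unset Printing Implicit Defensive.

Import Order.TTheory GRing.Theory Num.Theory.
Import numFieldNormedType.Exports.

Local Open Scope classical_set_scope.
Local Open Scope ring_scope.
Local Open Scope ereal_scope.

Section lebesgue_cons.
Context {R : realType} {n : nat}.
Local Notation T := (measurableTypeR R).
Variable m : {sigma_finite_measure set (n.-tuple T) -> \bar R}.

Definition tcons (x : T * n.-tuple T) : n.+1.-tuple T := [tuple of x.1 :: x.2].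

Definition tuncons (t : n.+1.-tuple T) : T * n.-tuple T :=
  (thead t, [tuple of behead t]).

Lemma tconsK : cancel tcons tuncons.
Proof. by case=> a t; congr (_, _); exact/val_inj. Qed.

Lemma tunconsK : cancel tuncons tcons.
Proof. by move=> t; rewrite [RHS]tuple_eta. Qed.

Lemma measurable_tcons : measurable_fun [set: T * n.-tuple T] tcons.
Proof.
exact: (@measurable_cons _ _ (T * n.-tuple T)%type T fst n snd).
Qed.

Lemma measurable_tuncons : measurable_fun [set: n.+1.-tuple T] tuncons.
Proof.
apply: (@measurable_fun_pair _ _ _ _ _ _ (fun t : n.+1.-tuple T => thead t)
  (fun t : n.+1.-tuple T => [tuple of behead t])).
- exact: measurable_tnth.
- exact: measurable_behead.
Qed.

Definition lebesgue_cons : set (n.+1.-tuple T) -> \bar R :=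
  pushforward (@lebesgue_measure R \x m) tcons.

Let lebesgue_cons0 : lebesgue_cons set0 = 0.
Proof. by rewrite /lebesgue_cons /pushforward preimage_set0 measure0. Qed.

Let lebesgue_cons_ge0 A : 0 <= lebesgue_cons A.
Proof. exact: (measure_ge0 (@lebesgue_measure R \x m)). Qed.

Let lebesgue_cons_sigma_additive : semi_sigma_additive lebesgue_cons.
Proof.
exact: (@measure_semi_sigma_additive _ _ _
  (measure_function_pushforward__canonical__measure_function_Measure
    (@lebesgue_measure R \x m) measurable_tcons)).
Qed.

HB.instance Definition _ := isMeasure.Build _ _ _ lebesgue_cons
  lebesgue_cons0 lebesgue_cons_ge0 lebesgue_cons_sigma_additive.

Let lebesgue_cons_sigma_finite : sigma_finite [set: n.+1.-tuple T] lebesgue_cons.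
Proof.
have /sigma_finiteP[F [TF ndF Foo]] := sigma_finiteT (@lebesgue_measure R).
have /sigma_finiteP[G [TG ndG Goo]] := sigma_finiteT m.
exists (fun k => tuncons @^-1` (F k `*` G k)).
  apply/esym/seteqP; split=> // t _.
  have [i _ Fi] : (\bigcup_i F i) (tuncons t).1 by rewrite -TF.
  have [j _ Gj] : (\bigcup_j G j) (tuncons t).2 by rewrite -TG.
  exists (maxn i j) => //; split.
  - by apply: subsetPset (ndF _ _ (leq_maxl i j)) _ Fi.
  - by apply: subsetPset (ndG _ _ (leq_maxr i j)) _ Gj.
move=> k; have [mF Fkoo] := Foo k; have [mG Gkoo] := Goo k; split.
  rewrite -[X in measurable X]setTI.
  by apply: measurable_tuncons => //; exact: measurableX.
rewrite /lebesgue_cons /pushforward -comp_preimage.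
rewrite (_ : tuncons \o tcons = id); last first.
  by apply/funext => x /=; rewrite tconsK.
by rewrite preimage_id product_measure1E// lte_mul_pinfty// ge0_fin_numE.
Qed.

HB.instance Definition _ := Measure_isSigmaFinite.Build _ _ _ lebesgue_cons
  lebesgue_cons_sigma_finite.

End lebesgue_cons.

Fixpoint lebesgue_borel (R : realType) (n : nat) :
    {sigma_finite_measure set (n.-tuple (measurableTypeR R)) -> \bar R} :=
  match n with
  | 0%N => \d_ ([tuple] : 0.-tuple (measurableTypeR R))
  | n'.+1 => lebesgue_cons (lebesgue_borel R n')
  end.

(* Lebesgue measure on R^n is the completion of the n-fold product of
   [lebesgue_measure]. The points of [Rn R n] are the n-tuples of reals, and
   its measurable sets are all the Lebesgue (not only the Borel) ones. As
   [lebesgue n] is a Caratheodory extension, its value on an arbitrary set is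
   the Lebesgue outer measure of that set. *)
Definition Rn (R : realType) (n : nat) :=
  caratheodory_type (mu_ext (lebesgue_borel R n)).

Definition lebesgue {R : realType} (n : nat) :
    {measure set (Rn R n) -> \bar R} :=
  @completed_measure_extension _ _ _ (lebesgue_borel R n).

Section maximal_operators.
Context {R : realType}.

Definition box n (I : 'I_n -> set R) : set (Rn R n) :=
  [set x | forall i, I i (tnth (x : n.-tuple R) i)].

(* The sides may be open, closed or half-open. *)
Definition interval_sides n (I : 'I_n -> set R) :=
  forall i, is_interval (I i) /\ 0 < lebesgue_measure (I i) < +oo.

Definition len (A : set R) : R := fine (lebesgue_measure A).

Definition maximal n (B : set (set (Rn R n))) (f : Rn R n -> R) (x : Rn R n) :
    \bar R :=
  ereal_sup [set (lebesgue n Q)^-1 * \int[lebesgue n]_(y in Q) `|f y|%:E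
            | Q in [set Q | B Q /\ Q x]].

Definition log2 (u : R) : R := (ln u / ln 2)%R.

(* [ln 0 = 0], so that [logp 0 = 0]. *)
Definition logp (u : R) : R := Num.max (log2 u) 0%R.

Definition weak_type_estimate n (B : set (set (Rn R n))) (phi : R -> R)
    (C : R) :=
  forall (f : Rn R n -> R) (a : R), measurable_fun [set: Rn R n] f ->
    (0 < a)%R ->
    lebesgue n [set x | a%:E < maximal B f x] <=
      C%:E * \int[lebesgue n]_x (phi (`|f x| / a)%R)%:E.

(* The constant [Cn] is a parameter so that it can be chosen as a function of
   the dimension [n] alone, uniformly in the basis [B].
   Only the restriction of [phi] to [0, +oo[ matters. The normalisation
   [phi 0 = 0] cannot be dropped: if [0 < phi 0], the integral over R^n of
   [phi (|f| / a)] is always infinite and the estimate is void. *)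
Definition sharp_weak_type n (Cn : R) (B : set (set (Rn R n))) :=
  weak_type_estimate B (fun u => u * (1 + logp u) ^+ n.-1)%R Cn /\
  forall phi : R -> R,
    {in `[0%R, +oo[, forall u, (0 <= phi u)%R} ->
    phi 0%R = 0%R ->
    convex_function (`[0%R, +oo[%classic : set R) phi ->
    {in `[0%R, +oo[ &, {homo phi : u v / (u <= v)%R}} ->
    (phi u / (u * (1 + log2 u) ^+ n.-1))%R @[u --> +oo%R] --> (0%R : R) ->
    ~ exists C : R, weak_type_estimate B phi C.

Definition dyadic : set R := [set (2 ^ s)%R | s in [set: int]].

(* The first n coordinates of R^(n+1) have the indices [lower i], for
   [i : 'I_n], and the last coordinate has the index [ord_max]. *)
Definition lower n (i : 'I_n) : 'I_n.+1 := widen_ord (leqnSn n) i.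

Definition basis_div n p (T : 'I_n -> set R) (G : set int) (j : 'I_p -> 'I_n) :
    set (set (Rn R n.+1)) :=
  [set Q | exists I : 'I_n.+1 -> set R,
    [/\ interval_sides I, Q = box I,
        forall i, T i (len (I (lower i))) &
        exists2 g, G g &
          len (I ord_max) = (2 ^ g / \prod_(k < p) len (I (lower (j k))))%R]].

Definition basis_mul n p (T : 'I_n -> set R) (G : set int) (j : 'I_p -> 'I_n) :
    set (set (Rn R n.+1)) :=
  [set Q | exists I : 'I_n.+1 -> set R,
    [/\ interval_sides I, Q = box I,
        forall i, T i (len (I (lower i))) &
        exists2 g, G g &
          len (I ord_max) = (2 ^ g * \prod_(k < p) len (I (lower (j k))))%R]].

End maximal_operators.

(* Main.v *)
Require Import Defs.
From mathcomp Require Import all_boot all_order all_algebra.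
From mathcomp Require Import all_classical all_reals all_analysis.
From mathcomp Require Import measurable_realfun.
From mathcomp Require Import ring lra zify.

(** Upper estimate. All sides of the boxes of both bases have dyadic lengths
    [2 ^ s], so such a box lies in the product of the dyadic intervals of the
    same lengths and of their neighbours ([dyadic_box_triple]); this costs a
    factor [3 ^ N] in the averages and leaves a countable family of boxes. By
    continuity of the measure ([measure_countable_bigcup_le]) finitely many of
    them suffice, and these are unions of cells of one grid ([common_grid]).
    On a finite grid the strong maximal inequality is a statement about finite
    sums ([grid_weak_type]). It is proved by induction on the dimension: a
    one-dimensional weak type inequality in the first variable, applied to the
    maximal function in the others, whose large values are controlled by the
    induction hypothesis at the dyadic levels; each new variable costs one
    logarithm. The discrete function is the average of [f] over the cells, and
    [orlicz_jensen] goes back from averages to [f] ([grid_box_weak_type]).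

    Sharpness. Fix [q], let [k = n * q], and choose exponents
    [a i 0 < ... < a i q] in each [T i] and exponents [g 0 << ... << g k] in
    [G], so sparse that the length of the last side belonging to
    [g (k - sigma)] increases strictly when [sigma] decreases, whatever
    the other sides are. Let [E] be the set of the points whose binary
    digits vanish at the positions [a i 0 .. a i q.-1] in the coordinate [i]
    and at [k] positions separating the last sides in the last coordinate.
    For each [t : 'I_n -> 'I_q.+1], a box with the sides
    [2 ^ a i (t i)] and the last side belonging to [g (k - sum t)] averages
    over exactly [t i] of the digits in the coordinate [i] and over [k - sum t]
    digits in the last one, [k] digits in all. So the maximal function of the
    indicator of [E] is at least [2 ^- k] at the points whose digits vanish at
    the remaining positions, those above the sides of the box. Requiring
    moreover that in each coordinate [i] with [0 < t i] the digit at the next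
    lower position [a i (t i).-1] is [1] makes these sets disjoint for the
    [q.+1 ^ n] choices of [t], and each of them has at least [2 ^ k / 2 ^ n]
    times the measure of [E] ([digit_lower_bound], [sharpness_bound]). Hence
    [phi (2 ^+ k.+1)] is at least a constant times [2 ^ k * q.+1 ^ n], which is
    of the order of [u * (1 + log2 u) ^ n] at [u = 2 ^ k.+1]
    ([little_o_contradiction]). *)

Set Implicit Arguments.
Unset Strict Implicit.
Unset Printing Implicit Defensive.

Import Order.TTheory GRing.Theory Num.Theory.
Import numFieldNormedType.Exports.

Local Open Scope classical_set_scope.
Local Open Scope ring_scope.

(** * The Lebesgue measure of boxes *)

Section boxes.
Local Open Scope ereal_scope.
Context {R : realType}.
Local Notation T := (measurableTypeR R).

Lemma measurable_box_borel n (I : 'I_n -> set T) :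
  (forall i, measurable (I i)) ->
  measurable [set x : n.-tuple T | forall i, I i (tnth x i)].
Proof.
move=> mI.
rewrite (_ : [set x | _] = \bigcap_(i in [set: 'I_n])
    ((fun x : n.-tuple T => tnth x i) @^-1` I i)); last first.
  by apply/seteqP; split=> x /= h i; [move=> _; exact: h|exact: (h i)].
apply: fin_bigcap_measurable => // i _.
rewrite -[X in measurable X]setTI.
exact: (@measurable_tnth _ T n i measurableT _ (mI i)).
Qed.

Lemma lebesgue_borel_box n (I : 'I_n -> set T) (l : 'I_n -> R) :
  (forall i, measurable (I i)) ->
  (forall i, lebesgue_measure (I i) = (l i)%:E) ->
  lebesgue_borel R n [set x : n.-tuple T | forall i, I i (tnth x i)] =
  (\prod_i l i)%:E.
Proof.
elim: n I l => [|n IH] I l mI lI.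
  by rewrite big_ord0 /= /dirac indicE mem_set// => -[].
rewrite big_ord_recl EFinM -(lI ord0) -(IH (fun i => I (lift ord0 i))) //.
set J := [set x : n.-tuple T | forall i, I (lift ord0 i) (tnth x i)].
have mJ : measurable J.
  exact: (measurable_box_borel (fun i => mI (lift ord0 i))).
have := product_measure1E (@lebesgue_measure R) (lebesgue_borel R n)
  (mI ord0) mJ.
move=> /= <-.
rewrite /lebesgue_cons /pushforward; congr (_ _).
apply/seteqP; split=> -[a t] /=.
  move=> h; split; first exact: (h ord0).
  by move=> i; have := h (lift ord0 i); rewrite tnthS.
move=> [ha ht] i; case: (unliftP ord0 i) => [j ->|->//].
by rewrite tnthS.
Qed.

Lemma lebesgueE n (A : set (n.-tuple T)) : measurable A ->
  lebesgue n (A : set (Rn R n)) = lebesgue_borel R n A.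
Proof. by move=> mA; exact: measurable_mu_extE. Qed.

Lemma measurable_Rn n (A : set (n.-tuple T)) : measurable A ->
  measurable (A : set (Rn R n)).
Proof. exact: caratheodory_measurable_mu_ext. Qed.

(** For arbitrary sets: [lebesgue n] is an outer measure. *)
Lemma le_lebesgue n (A B : set (Rn R n)) : A `<=` B ->
  lebesgue n A <= lebesgue n B.
Proof. by move=> AB; exact: (le_mu_ext (lebesgue_borel R n) AB). Qed.

Lemma measurable_box n (I : 'I_n -> set R) :
  (forall i, measurable (I i : set T)) -> measurable (box I).
Proof. by move=> mI; apply: measurable_Rn; exact: measurable_box_borel. Qed.

Lemma lebesgue_box n (I : 'I_n -> set R) (l : 'I_n -> R) :
  (forall i, measurable (I i : set T)) ->
  (forall i, lebesgue_measure (I i) = (l i)%:E) ->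
  lebesgue n (box I) = (\prod_i l i)%:E.
Proof.
move=> mI lI; rewrite lebesgueE; last exact: measurable_box_borel.
exact: lebesgue_borel_box.
Qed.

End boxes.

(** * The function logp *)

Section binary_logarithm.
Context {R : realType}.
Implicit Types u v w : R.

Lemma logp_ge0 u : 0 <= logp u.
Proof. by rewrite /logp le_max lexx orbT. Qed.

Lemma ln2_gt0 : 0 < ln 2 :> R.
Proof. by rewrite ln_gt0// ltr1n. Qed.

Lemma logp0 : logp 0 = 0 :> R.
Proof. by rewrite /logp /log2 ln0// mul0r maxxx. Qed.

Lemma le_logp u v : 0 <= u -> u <= v -> logp u <= logp v.
Proof.
rewrite le_eqVlt => /orP[/eqP <- _|u0 uv]; first by rewrite logp0 logp_ge0.
rewrite /logp ge_max !le_max lexx orbT andbT; apply/orP; left; rewrite /log2.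
by rewrite ler_pM2r ?invr_gt0 ?ln2_gt0// ler_ln ?posrE ?uv// (lt_le_trans u0).
Qed.

Lemma logp_exp2M k u : 0 <= u -> logp (2 ^+ k * u) <= k%:R + logp u.
Proof.
rewrite le_eqVlt => /orP[/eqP <-|u0].
  by rewrite mulr0 logp0 addr0 ler0n.
have k0 : (0 : R) < 2 ^+ k by rewrite exprn_gt0.
rewrite {1}/logp ge_max addr_ge0 ?logp_ge0 ?ler0n// andbT /log2.
rewrite lnM ?posrE// lnXn// mulrDl -[ln 2 *+ k]mulr_natl mulfK ?gt_eqF ?ln2_gt0//.
by rewrite lerD2l /logp le_max lexx.
Qed.

Lemma log2_exp2 k : log2 (2 ^+ k) = k%:R :> R.
Proof. by rewrite /log2 lnXn// -[ln 2 *+ k]mulr_natl mulfK// gt_eqF// ln2_gt0. Qed.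

Lemma le_natr_logp k j u : 0 < u -> 2 ^+ j < 2 ^+ k * u ->
  j%:R <= k%:R + logp u.
Proof.
move=> u0 h; rewrite (le_trans _ (logp_exp2M k (ltW u0)))//.
rewrite (le_trans _ (le_logp _ (ltW h))) ?exprn_ge0//.
by rewrite /logp log2_exp2 le_max lexx.
Qed.

Lemma measurable_logp : measurable_fun [set: R] (@logp R).
Proof.
apply: measurable_maxr => //.
by apply: measurable_funM => //; exact: measurable_ln.
Qed.

End binary_logarithm.

(** * The one-sided maximal inequality on a finite grid *)

Section one_dimensional.
Context {R : realType}.

(** The queue recursion: [queue g t m] is the largest sum of [g - t] over a
    (possibly empty) run of consecutive indices ending just before [m]. *)
Fixpoint queue (g : nat -> R) (t : R) (m : nat) : R :=
  if m is m'.+1 then Num.max 0 (queue g t m' + g m' - t) else 0.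

Lemma queue_ge0 g t m : 0 <= queue g t m.
Proof. by case: m => [|m] //=; rewrite le_max lexx. Qed.

Lemma run_le_queue g t a m : \sum_(a <= i < m) (g i - t) <= queue g t m.
Proof.
elim: m => [|m IH]; first by rewrite big_geq.
have [am|ma] := leqP a m; last by rewrite big_geq// queue_ge0.
rewrite big_nat_recr//= le_max; apply/orP; right.
by rewrite -addrA lerD2r.
Qed.

(** The load [g] that arrives is either still in the queue or was processed, at
    most [t] at each time when the queue is not empty. *)
Lemma busy_queue g t m : 0 <= t -> (forall i, 0 <= g i) ->
  t * (\sum_(i < m) (0 < queue g t i.+1)%R%:R) + queue g t m <= \sum_(i < m) g i.
Proof.
move=> t0 g0; elim: m => [|m IH]; first by rewrite !big_ord0 mulr0 addr0.
rewrite !big_ord_recr /=; set q := queue g t m in IH *.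
have q0 : 0 <= q := queue_ge0 g t m.
have gm := g0 m.
by rewrite lt_max ltxx /=; case: (ltP 0 (q + g m - t)) => h /=; lra.
Qed.

(** The weak type (1, 1) inequality with constant 1 for averages to the left:
    if some run ending at [x] has an average above [t], then the queue is not
    empty after [x]. *)
Lemma one_sided_weak M (g : 'I_M -> R) t : 0 <= t -> (forall i, 0 <= g i) ->
  t * #|[pred x : 'I_M | [exists a : 'I_M, (a <= x)%N &&
            (0 < \sum_(y < M | (a <= y <= x)%N) (g y - t))]]|%:R <= \sum_y g y.
Proof.
move=> t0 g0.
(* [e] extends [g] by 0 to all of [nat], the domain of [queue]. *)
pose e (i : nat) : R := \sum_(y < M | y == i :> nat) g y.
have eE (y : 'I_M) : e y = g y.
  by rewrite /e (eq_bigl (pred1 y)) ?big_pred1_eq// => z; rewrite -val_eqE.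
have e0 i : 0 <= e i by exact: sumr_ge0.
rewrite (eq_bigr (fun y : 'I_M => e y)); last by move=> y _; rewrite eE.
apply: le_trans (busy_queue M t0 e0).
rewrite -[leLHS]addr0 lerD ?queue_ge0// ler_wpM2l//.
rewrite -sum1_card natr_sum big_mkcond /= ler_sum// => x _.
case: ifPn => // /existsP[a /andP[ax]].
set s := (X in 0 < X).
have -> : s = \sum_(a <= i < x.+1) (e i - t).
  rewrite (big_nat_widen _ _ M)// (big_nat_widenl _ 0%N)// big_mkord.
  by apply: eq_big => [y|y _]; [rewrite /= ltnS andbC|rewrite eE].
by move=> s0; rewrite (lt_le_trans s0 (run_le_queue _ _ _ _)).
Qed.

End one_dimensional.

(** * The two-sided maximal inequality on a finite grid *)

Definition between M (I : 'I_M.+1 * 'I_M.+1) (x : 'I_M) : bool :=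
  (I.1 <= x < I.2)%N.

Section two_sided.
Context {R : realType} {M : nat}.
Implicit Types (g : 'I_M -> R) (t : R).

(** [0 < \sum (g y - t)] says that the average of [g] exceeds [t] without a
    division. *)
Definition has_big_average1 g t (x : 'I_M) :=
  [exists I, between I x && (0 < \sum_(y | between I y) (g y - t))].

(** The two halves of the interval overlap at [x], so the sum of their lengths
    is at most twice the length of the interval; one of them therefore has an
    average above [t / 2]. *)
Lemma has_big_average1_split g t x : 0 <= t -> (forall i, 0 <= g i) ->
  has_big_average1 g t x ->
  [exists a : 'I_M, (a <= x)%N &&
      (0 < \sum_(y < M | (a <= y <= x)%N) (g y - t / 2))] ||
  [exists b : 'I_M, (x <= b)%N &&
      (0 < \sum_(y < M | (x <= y <= b)%N) (g y - t / 2))].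
Proof.
move=> t0 g0 /existsP[[a b]] /andP[] /=; rewrite /between /= => /andP[ax xb] h.
have aM : (a < M)%N by rewrite (leq_ltn_trans ax).
have b0 : (0 < b)%N by exact: leq_ltn_trans xb.
have bM : (b.-1 < M)%N by rewrite prednK// -ltnS.
set L := \sum_(y < M | (a <= y <= x)%N) (g y - t / 2).
set U := \sum_(y < M | (x <= y <= b.-1)%N) (g y - t / 2).
suff : 0 < L + U.
  move=> LU; apply/orP; have [L0|L0] := ltP 0 L.
    by left; apply/existsP; exists (Ordinal aM); rewrite /= ax L0.
  right; apply/existsP; exists (Ordinal bM); rewrite /= -ltnS prednK// xb /=.
  by move: LU L0; rewrite /U; lra.
suff : \sum_(y < M | (a <= y < b)%N) (g y - t) <= L + U by exact: lt_le_trans.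
have xab : (a <= x < b)%N by rewrite ax.
have xb' : (x <= b.-1)%N by rewrite -ltnS prednK.
rewrite (bigD1 x)//= [L](bigD1 x) ?ax ?leqnn//= [U](bigD1 x) ?leqnn ?xb'//=.
set S := \sum_(i < M | _) _.
set L' := \sum_(i < M | _) _; set U' := \sum_(i < M | _) _.
suff : S <= L' + U' by have := g0 x; lra.
rewrite /S (bigID (fun y : 'I_M => (y < x)%N)) /= lerD//.
  rewrite [leLHS](eq_bigl (fun y : 'I_M => (a <= y <= x)%N && (y != x))).
    by apply: ler_sum => y _; rewrite lerD2l lerN2; lra.
  move=> y; rewrite -val_eqE /=; lia.
rewrite [leLHS](eq_bigl (fun y : 'I_M => (x <= y <= b.-1)%N && (y != x))).
  by apply: ler_sum => y _; rewrite lerD2l lerN2; lra.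
move=> y; rewrite -val_eqE /=; lia.
Qed.

Lemma two_sided_weak g t : 0 <= t -> (forall i, 0 <= g i) ->
  t * #|[pred x | has_big_average1 g t x]|%:R <= 4 * \sum_y g y.
Proof.
move=> t0 g0.
pose Lf g := [pred x : 'I_M | [exists a : 'I_M, (a <= x)%N &&
            (0 < \sum_(y < M | (a <= y <= x)%N) (g y - t / 2))]].
pose g' x := g (rev_ord x).
have t20 : 0 <= t / 2 by lra.
have L1 := one_sided_weak t20 g0.
have L2 := one_sided_weak t20 (fun i => g0 (rev_ord i)).
have E2 : \sum_y g (rev_ord y) = \sum_y g y.
  by rewrite [RHS](reindex_inj rev_ord_inj).
rewrite {}E2 in L2.
suff : (#|[pred x | has_big_average1 g t x]| <= #|Lf g| + #|Lf g'|)%N.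
  rewrite -(ler_nat R) natrD => /(ler_wpM2l t0).
  by move: L1 L2; rewrite -/(Lf g) -/(Lf g'); lra.
rewrite -(fintype.card_image (@rev_ord_inj M) (Lf g')) -cardUI.
apply: leq_trans (leq_addr _ _); apply/subset_leq_card/fintype.subsetP => x.
rewrite !inE => /(has_big_average1_split t0 g0) /orP[->//|].
move=> /existsP[b /andP[xb bs]]; apply/orP; right.
rewrite -[x]rev_ordK fintype.mem_image; last exact: rev_ord_inj.
rewrite inE; apply/existsP; exists (rev_ord b); apply/andP; split.
  by rewrite /= leq_sub2l.
rewrite (reindex_inj rev_ord_inj) /=; move: bs; congr (0 < _).
apply: eq_big => [y|y _]; last by rewrite /g' rev_ordK.
have := ltn_ord y; have := ltn_ord x; have := ltn_ord b; lia.
Qed.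

(** Truncation: the part of [g] below [t] cannot push an average above [2 t]. *)
Lemma truncated_weak g t : 0 < t -> (forall i, 0 <= g i) ->
  t * #|[pred x | has_big_average1 g (2 * t) x]|%:R <=
  4 * \sum_(y | t < g y) g y.
Proof.
move=> t0 g0; rewrite big_mkcond /=.
pose h y := if t < g y then g y else 0.
have h0 y : 0 <= h y by rewrite /h; case: ifP.
apply: le_trans (two_sided_weak (ltW t0) h0).
rewrite ler_wpM2l ?(ltW t0)// ler_nat.
apply/subset_leq_card/fintype.subsetP => x; rewrite !inE.
move=> /existsP[I /andP[xI hI]]; apply/existsP; exists I; rewrite xI /=.
apply: lt_le_trans hI _; apply: ler_sum => y _.
by rewrite /h; case: ltP; have := g0 y; lra.
Qed.

End two_sided.

Section dyadic_sums.
Context {R : realType}.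

(** If [2 ^ i * t] is the last level below [v], then the term [j = i] alone is
    at least [v]. *)
Lemma layer_cake (v t : R) J : 0 < t -> 0 <= v -> v <= 2 ^+ J * t ->
  (if t < v then v else 0) <=
  \sum_(j < J) 2 ^+ j.+1 * t * (2 ^+ j * t < v)%R%:R.
Proof.
move=> t0 v0; elim: J => [|J IH] vJ.
  by rewrite big_ord0 ltNge -[t]mul1r vJ.
rewrite big_ord_recr /=; have [h|h] := ltP (2 ^+ J * t) v; last first.
  by rewrite mulr0 addr0 IH.
rewrite mulr1 ler_wpDl//.
  by apply: sumr_ge0 => j _; rewrite !mulr_ge0 ?exprn_ge0// ltW.
by case: ifP => // _; exact: le_trans vJ.
Qed.

Lemma sum_exp2_lt (w : R) J : 0 <= w ->
  \sum_(j < J) 2 ^+ j * (2 ^+ j < w)%R%:R <= 2 * w.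
Proof.
move=> w0; elim: J => [|J IH]; first by rewrite big_ord0 mulr_ge0.
rewrite big_ord_recr /=; have [h|h] := ltP (2 ^+ J) w; last first.
  by rewrite mulr0 addr0 IH.
have S K : \sum_(j < K) 2 ^+ j * (2 ^+ j < w)%R%:R <= 2 ^+ K :> R.
  elim: K {IH h} => [|K IH]; first by rewrite big_ord0.
  rewrite big_ord_recr /= exprS mulrDl mul1r lerD//.
  by rewrite ler_piMr ?exprn_ge0// lern1 leq_b1.
by rewrite mulr1; have := S J; lra.
Qed.

Lemma count_le (x : R) J : 0 <= x ->
  \sum_(j < J) (j%:R <= x)%R%:R <= x + 1.
Proof.
move=> x0; elim: J => [|J IH]; first by rewrite big_ord0 addr_ge0.
rewrite big_ord_recr /=; have [h|h] := leP J%:R x; last by rewrite addr0.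
rewrite lerD//; apply: le_trans h.
rewrite -[X in _ <= X%:R](card_ord J) -sum1_card natr_sum ler_sum// => j _.
by rewrite lern1 leq_b1.
Qed.

End dyadic_sums.

(** * The strong maximal inequality on a finite grid *)

Section strong_maximal.
Context {R : realType} {M : nat}.
Local Notation interval := ('I_M.+1 * 'I_M.+1)%type.

Local Notation "x ::: y" := [tuple of x :: (y : _.-tuple _)]
  (at level 60, only parsing).

Lemma sum_tuple_cons (F : finType) n (f : n.+1.-tuple F -> R) :
  \sum_c f c = \sum_x \sum_y f (x ::: y).
Proof.
rewrite pair_bigA /= (reindex (fun p : F * n.-tuple F => [tuple of p.1 :: p.2])) //.
exists (fun c => (thead c, [tuple of behead c])).
  by move=> [x y] _; congr (_, _); exact/val_inj.
by move=> c _; rewrite /= -tuple_eta.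
Qed.

(** [all2] computes on cons, which is what the induction on the dimension
    uses. *)
Definition in_grid_box n (Q : n.-tuple interval) (c : n.-tuple 'I_M) :=
  all2 (@between M) Q c.

Definition has_big_average n (g : n.-tuple 'I_M -> R) t c :=
  [exists Q, in_grid_box Q c && (0 < \sum_(d | in_grid_box Q d) (g d - t))].

Definition grid_maximal n (g : n.-tuple 'I_M -> R) c :=
  \big[Num.max/0]_(Q | in_grid_box Q c)
    ((\sum_(d | in_grid_box Q d) g d) / #|[pred d | in_grid_box Q d]|%:R).

Lemma grid_box_card_gt0 n (Q : n.-tuple interval) c : in_grid_box Q c ->
  (0 : R) < #|[pred d | in_grid_box Q d]|%:R.
Proof. by move=> Qc; rewrite ltr0n; apply/card_gt0P; exists c. Qed.

Lemma sum_subE n (Q : n.-tuple interval) (g : n.-tuple 'I_M -> R) t :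
  \sum_(d | in_grid_box Q d) (g d - t) =
  \sum_(d | in_grid_box Q d) g d - #|[pred d | in_grid_box Q d]|%:R * t.
Proof. by rewrite sumrB sumr_const mulr_natl. Qed.

Lemma grid_maximal_gt n (g : n.-tuple 'I_M -> R) t c : 0 <= t ->
  t < grid_maximal g c -> has_big_average g t c.
Proof.
move=> t0 /bigmax_gtP[|[Q Qc]]; first by rewrite ltNge t0.
rewrite ltr_pdivlMr ?(grid_box_card_gt0 Qc)// => h.
by apply/existsP; exists Q; rewrite Qc sum_subE subr_gt0 mulrC.
Qed.

Lemma grid_maximal_ge n (g : n.-tuple 'I_M -> R) t Q c : in_grid_box Q c ->
  \sum_(d | in_grid_box Q d) (g d - t) <=
  #|[pred d | in_grid_box Q d]|%:R * (grid_maximal g c - t).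
Proof.
move=> Qc; rewrite sum_subE mulrBr lerD2r mulrC.
rewrite -ler_pdivrMr ?(grid_box_card_gt0 Qc)//.
rewrite /grid_maximal; exact: le_bigmax_cond.
Qed.

Lemma grid_maximal_ge0 n (g : n.-tuple 'I_M -> R) c : 0 <= grid_maximal g c.
Proof. by rewrite /grid_maximal; exact: bigmax_ge_id. Qed.

(** A box is a product of an interval and a box of lower dimension; averaging
    first over the latter bounds the average over the box by a one-dimensional
    average of the maximal function of the slices. *)
Lemma has_big_average_cons n (g : n.+1.-tuple 'I_M -> R) t x y :
  has_big_average g t (x ::: y) ->
  has_big_average1 (fun z => grid_maximal (fun w => g (z ::: w)) y) t x.
Proof.
move=> /existsP[Q /andP[]]; rewrite (tuple_eta Q).
set I := thead Q; set Q' := [tuple of behead Q] => /= /andP[Ix Q'y].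
rewrite big_mkcond sum_tuple_cons /= => h.
apply/existsP; exists I; rewrite Ix /=.
rewrite -(pmulr_rgt0 _ (grid_box_card_gt0 Q'y)) mulr_sumr.
apply: lt_le_trans h _; rewrite [leRHS]big_mkcond; apply: ler_sum => z _.
rewrite -big_mkcond /=; case: ifPn => zI.
  apply: le_trans (grid_maximal_ge _ _ Q'y).
  by rewrite le_eqVlt; apply/orP; left; apply/eqP/eq_bigl => w; rewrite /in_grid_box /= zI.
by rewrite big_pred0// => w; rewrite /in_grid_box /= (negbTE zI).
Qed.

(** One more variable: Fubini in the form of an exchange of finite sums, with
    the weak type inequality in the new variable and the layer cake formula
    for the maximal function in the others. *)
Lemma level_sets_cons n (Theta : R -> R) :
  (forall (g : n.-tuple 'I_M -> R) t, (forall c, 0 <= g c) -> 0 < t ->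
    #|[pred c | has_big_average g t c]|%:R <= \sum_c Theta (g c / t)) ->
  forall (g : n.+1.-tuple 'I_M -> R) t, (forall c, 0 <= g c) -> 0 < t ->
    exists J : nat, #|[pred c | has_big_average g t c]|%:R <=
      \sum_c 8 * \sum_(j < J) 2 ^+ j * Theta (2 * (g c / t) / 2 ^+ j).
Proof.
move=> IH g t g0 t0; pose s := t / 2.
have s0 : 0 < s by rewrite /s; lra.
have ts : t = 2 * s by rewrite /s; lra.
pose G y x := grid_maximal (fun w => g (x ::: w)) y.
have G0 y x : 0 <= G y x by exact: grid_maximal_ge0.
(* [J] bounds the number of dyadic levels at which [G] is to be cut. *)
have [J hJ] : exists J, forall y x, G y x <= 2 ^+ J * s.
  pose m := \sum_y \sum_x G y x.
  exists (Num.truncn (m / s)).+1 => y x.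
  have Gm : G y x <= m.
    rewrite /m (bigD1 y)//= (bigD1 x)//= -addrA lerDl addr_ge0//.
      exact: sumr_ge0.
    by apply: sumr_ge0 => ? _; exact: sumr_ge0.
  rewrite -ler_pdivrMr//; apply: (@le_trans _ _ (m / s)).
    by rewrite ler_pM2r ?invr_gt0.
  apply: (@le_trans _ _ (Num.truncn (m / s)).+1%:R).
    by rewrite ltW// truncnS_gt.
  by rewrite -natrX ler_nat ltnW// ltn_expl.
exists J.
have -> : #|[pred c | has_big_average g t c]|%:R =
    \sum_y \sum_x (has_big_average g t (x ::: y))%:R :> R.
  rewrite -sum1_card natr_sum big_mkcond sum_tuple_cons exchange_big /=.
  by apply: eq_bigr => y _; apply: eq_bigr => x _; rewrite inE; case: ifP.
have step1 y : \sum_x (has_big_average g t (x ::: y))%:R <=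
    8 * \sum_(j < J) \sum_x 2 ^+ j * (2 ^+ j * s < G y x)%R%:R :> R.
  apply: (@le_trans _ _ #|[pred x | has_big_average1 (G y) t x]|%:R).
    rewrite -sum1_card natr_sum [leRHS]big_mkcond /=; apply: ler_sum => x _.
    have := @has_big_average_cons n g t x y; rewrite inE /=.
    by case: (has_big_average _ _ _) => [/(_ isT) ->|_] //; case: ifP.
  have := truncated_weak s0 (G0 y); rewrite -ts -ler_pdivlMl// => /le_trans; apply.
  rewrite big_mkcond /= exchange_big /=.
  have lc x : (if s < G y x then G y x else 0) <= _ := layer_cake s0 (G0 y x) (hJ y x).
  apply: (@le_trans _ _ (s^-1 * (4 * \sum_x \sum_(j < J) 2 ^+ j.+1 * s * (2 ^+ j * s < G y x)%R%:R))).
    by rewrite !ler_pM2l ?invr_gt0//; apply: ler_sum.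
  rewrite !mulr_sumr; apply: ler_sum => x _; rewrite !mulr_sumr.
  apply: ler_sum => j _; rewrite exprS le_eqVlt; apply/orP; left; apply/eqP.
  by field; rewrite gt_eqF.
apply: (@le_trans _ _ (\sum_y (8 * \sum_(j < J) \sum_x 2 ^+ j * (2 ^+ j * s < G y x)%R%:R))).
  by apply: ler_sum => y _; exact: step1.
rewrite -!mulr_sumr ler_pM2l//.
rewrite exchange_big /= [leRHS]exchange_big /=; apply: ler_sum => j _.
rewrite exchange_big /= sum_tuple_cons; apply: ler_sum => x _.
have ts0 : 0 < 2 ^+ j * s by rewrite mulr_gt0// exprn_gt0.
rewrite -!mulr_sumr ler_pM2l ?exprn_gt0//.
apply: (@le_trans _ _ #|[pred y | has_big_average (fun w => g (x ::: w)) (2 ^+ j * s) y]|%:R).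
  rewrite -sum1_card natr_sum [leRHS]big_mkcond /=; apply: ler_sum => y _.
  case: ifPn => [_|]; first by rewrite lern1 leq_b1.
  rewrite inE; apply: contraNT => /=; rewrite -ltNge ltr0n lt0b => h.
  by apply: grid_maximal_gt; rewrite ?ltW.
apply: le_trans (IH _ _ _ ts0) _ => //.
rewrite le_eqVlt; apply/orP; left; apply/eqP/eq_bigr => y _; congr Theta.
by rewrite /s; field; rewrite !gt_eqF ?exprn_gt0.
Qed.

(** The truncation [2 ^- n.+1 < u] bounds the number of dyadic levels that
    contribute in [orlicz_trunc_sum] by [n.+3 + logp u]; without it the sum
    over the levels would diverge. *)
Definition orlicz_trunc (A : R) n (u : R) : R :=
  if 2 ^- n.+1 < u then A * (u * (1 + logp u) ^+ n) else 0.

Lemma orlicz_trunc0 A n : orlicz_trunc A n 0 = 0.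
Proof. by rewrite /orlicz_trunc mul0r mulr0 if_same. Qed.

(** Each of the about [logp u] levels [j] with a nonzero term contributes at
    most [2 * A * u * (2 + logp u) ^+ n]: this is where the exponent of the
    logarithm grows by one. *)
Lemma orlicz_trunc_sum (A : R) n u J : 0 <= A -> 0 <= u ->
  8 * (\sum_(j < J) 2 ^+ j * orlicz_trunc A n (2 * u / 2 ^+ j)) <=
  orlicz_trunc (16 * 2 ^+ n * n.+3%:R * A) n.+1 u.
Proof.
move=> A0; rewrite le_eqVlt => /orP[/eqP <-|u0].
  rewrite orlicz_trunc0 mulr0 big1 ?mulr0// => j _.
  by rewrite mul0r orlicz_trunc0 mulr0.
have e0 k : (0 : R) < 2 ^+ k by rewrite exprn_gt0.
have l0 := logp_ge0 u.
rewrite {2}/orlicz_trunc; case: ltP => hu; last first.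
  rewrite big1 ?mulr0// => j _; rewrite /orlicz_trunc ltNge.
  rewrite ifF ?mulr0//; apply/negbTE; rewrite negbK.
  rewrite ler_pdivrMr//; apply: (@le_trans _ _ (2 * 2 ^- n.+2)).
    by rewrite ler_pM2l.
  rewrite (exprS _ n.+1) invfM mulrA divff ?gt_eqF// mul1r.
  rewrite -[leLHS]mulr1 ler_pM2l ?invr_gt0//.
  by rewrite exprn_ege1// ler1n.
pose K := 2 * A * u * (2 + logp u) ^+ n.
have K0 : 0 <= K by rewrite !mulr_ge0 ?exprn_ge0 ?addr_ge0// ltW.
apply: (@le_trans _ _ (8 * (K * (n.+2%:R + logp u + 1)))).
  rewrite ler_pM2l// (le_trans _ (ler_wpM2l K0 (@count_le R _ J _)))//; last first.
    by rewrite addr_ge0.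
  rewrite mulr_sumr; apply: ler_sum => j _; rewrite /orlicz_trunc.
  case: ifPn => h; last by rewrite mulr0 mulr_ge0.
  have w0 : 0 < 2 * u / 2 ^+ j by rewrite divr_gt0// mulr_gt0.
  have -> : (j%:R <= n.+2%:R + logp u)%R.
    apply: le_natr_logp => //; move: h; rewrite -[_ < _ / _](ltr_pM2r (e0 j)).
    rewrite divfK ?gt_eqF// mulrC ltr_pdivrMr// => /lt_le_trans; apply.
    by rewrite (exprS _ n.+1) le_eqVlt; apply/orP; left; apply/eqP; ring.
  rewrite mulr1 /K.
  have lw : logp (2 * u / 2 ^+ j) <= 1 + logp u.
    apply: (@le_trans _ _ (logp (2 ^+ 1 * u))).
      apply: le_logp; first exact: ltW.
      by rewrite expr1 ler_piMr ?mulr_ge0 ?(ltW u0)// invf_le1// exprn_ege1// ler1n.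
    exact: logp_exp2M (ltW u0).
  have lw0 := logp_ge0 (2 * u / 2 ^+ j).
  have -> : 2 ^+ j * (A * (2 * u / 2 ^+ j * (1 + logp (2 * u / 2 ^+ j)) ^+ n)) =
    2 * A * u * (1 + logp (2 * u / 2 ^+ j)) ^+ n by field; rewrite gt_eqF.
  rewrite ler_wpM2l ?mulr_ge0 ?(ltW u0)// lerXn2r ?nnegrE ?addr_ge0//; lra.
rewrite /K.
have h1 : (2 + logp u) ^+ n <= 2 ^+ n * (1 + logp u) ^+ n.
  by rewrite -exprMn lerXn2r ?nnegrE ?addr_ge0 ?mulr_ge0 ?addr_ge0//; lra.
have h2 : n.+2%:R + logp u + 1 <= n.+3%:R * (1 + logp u).
  have n0 : 0 <= n%:R :> R by [].
  rewrite -![n.+3]addn3 -![n.+2]addn2 !natrD.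
  nra.
rewrite exprS.
apply: (@le_trans _ _ (8 * (2 * A * u * (2 ^+ n * (1 + logp u) ^+ n) *
                            (n.+3%:R * (1 + logp u))))).
  rewrite ler_pM2l//; apply: ler_pM h2; 
    [exact: K0|by apply: addr_ge0 => //; exact: addr_ge0|].
  by rewrite ler_wpM2l ?mulr_ge0 ?(ltW u0).
by rewrite le_eqVlt; apply/orP; left; apply/eqP; ring.
Qed.

(** In the first dimension the levels form a geometric sum, and no logarithm
    appears. *)
Lemma orlicz_trunc1_sum u J : 0 <= u ->
  8 * (\sum_(j < J) 2 ^+ j * (1 < 2 * u / 2 ^+ j)%R%:R) <=
  orlicz_trunc 32 0 u.
Proof.
move=> u0; have e0 k : (0 : R) < 2 ^+ k by rewrite exprn_gt0.
rewrite (eq_bigr (fun j : 'I_J => 2 ^+ j * (2 ^+ j < 2 * u)%R%:R)); last first.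
  by move=> j _; rewrite ltr_pdivlMr// mul1r.
rewrite /orlicz_trunc expr0 mulr1; case: ltP => h.
  have := @sum_exp2_lt _ (2 * u) J; rewrite mulr_ge0// => /(_ isT); lra.
rewrite big1 ?mulr0// => j _; rewrite ltNge.
suff -> : 2 * u <= 2 ^+ j by rewrite mulr0.
apply: (@le_trans _ _ 1); last by rewrite exprn_ege1// ler1n.
by move: h; rewrite expr1 -[X in u <= X]mul1r ler_pdivlMr// mulrC.
Qed.

Lemma empty_dimension (g : 0.-tuple 'I_M -> R) t : 0 < t ->
  #|[pred c | has_big_average g t c]|%:R <= \sum_c (1 < g c / t)%R%:R :> R.
Proof.
move=> t0; rewrite -sum1_card natr_sum [leLHS]big_mkcond /=.
apply: ler_sum => c _; case: ifPn => // /existsP[Q /andP[_]].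
rewrite (eq_bigl xpredT) => [|d]; last by rewrite tuple0 (tuple0 d).
rewrite (big_pred1 c) => [|d]; last by rewrite tuple0 (tuple0 d) /= eqxx.
by rewrite subr_gt0 ltr_pdivlMr// mul1r => ->.
Qed.

End strong_maximal.

(** By [level_sets_cons] from one dimension to the next; dimension one starts
    from the trivial estimate in dimension zero, where a box is the point. *)
Theorem grid_weak_type (R : realType) n : exists2 A : R, 0 <= A &
  forall M (g : n.+1.-tuple 'I_M -> R) t, (forall c, 0 <= g c) -> 0 < t ->
    #|[pred c | has_big_average g t c]|%:R <=
      \sum_c orlicz_trunc A n (g c / t).
Proof.
elim: n => [|n [A A0 IH]].
  exists 32 => // M g t g0 t0.
  have [J] := @level_sets_cons R M 0 (fun u => (1 < u)%R%:R)
    (fun g t _ => @empty_dimension R M g t) g t g0 t0.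
  move=> /le_trans; apply; apply: ler_sum => c _.
  by apply: orlicz_trunc1_sum; rewrite divr_ge0// ltW.
exists (16 * 2 ^+ n * n.+3%:R * A); first by rewrite !mulr_ge0 ?exprn_ge0.
move=> M g t g0 t0; have [J] := level_sets_cons (IH M) g0 t0.
move=> /le_trans; apply; apply: ler_sum => c _.
by apply: orlicz_trunc_sum; rewrite // divr_ge0// ltW.
Qed.

(** * Grids in R^n *)

Lemma in_grid_boxP M n (Q : n.-tuple ('I_M.+1 * 'I_M.+1)) (c : n.-tuple 'I_M) :
  reflect (forall i, between (tnth Q i) (tnth c i)) (in_grid_box Q c).
Proof.
elim: n Q c => [|n IH] Q c.
  by rewrite tuple0 (tuple0 c); constructor => -[].
rewrite (tuple_eta Q) (tuple_eta c) /in_grid_box /=.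
apply: (iffP andP) => [[h /(IH [tuple of behead Q] [tuple of behead c]) hi] i|h].
  by case: (unliftP ord0 i) => [j|] ->; rewrite ?tnthS ?tnth0.
split; first by have := h ord0; rewrite !tnth0.
apply/(IH [tuple of behead Q] [tuple of behead c]) => i.
by have := h (lift ord0 i); rewrite !tnthS.
Qed.

Section grids.
Context {R : realType} {N M : nat}.
Variables (o h : R).
Hypothesis h0 : 0 < h.
Local Notation interval := ('I_M.+1 * 'I_M.+1)%type.
Local Open Scope ereal_scope.

Definition half_open_box n (a b : 'I_n -> R) : set (Rn R n) :=
  box (fun i => `[a i, b i[%classic).

Lemma measurable_half_open_box n (a b : 'I_n -> R) :
  measurable (half_open_box a b).
Proof. by apply: measurable_box => i; exact: measurable_itv. Qed.

Lemma lebesgue_half_open_box n (a b : 'I_n -> R) : (forall i, (a i < b i)%R) ->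
  lebesgue n (half_open_box a b) = (\prod_i (b i - a i)%R)%:E.
Proof.
move=> ab; apply: lebesgue_box => i; first exact: measurable_itv.
by rewrite lebesgue_measure_itv /= lte_fin ab EFinB.
Qed.

(** The nodes [o + k * h] are the same in all coordinates. *)
Definition node (k : nat) : R := (o + k%:R * h)%R.

Definition cell (c : N.-tuple 'I_M) : set (Rn R N) :=
  half_open_box (fun i => node (tnth c i)) (fun i => node (tnth c i).+1).

Definition grid_box (Q : N.-tuple interval) : set (Rn R N) :=
  half_open_box (fun i => node (tnth Q i).1) (fun i => node (tnth Q i).2).

Definition cells (P : {pred N.-tuple 'I_M}) : set (Rn R N) :=
  \big[setU/set0]_(c <- enum P) cell c.

Lemma node_le k l : (node k <= node l)%R = (k <= l)%N.
Proof. by rewrite /node lerD2l ler_pM2r// ler_nat. Qed.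

Lemma lebesgue_cell c : lebesgue N (cell c) = (h ^+ N)%:E.
Proof.
rewrite lebesgue_half_open_box => [|i]; last by rewrite ltNge node_le ltnn.
rewrite (eq_bigr (fun=> h)) ?prodr_const ?card_ord// => i _.
by rewrite /node -natr1; ring.
Qed.

Lemma cell_inj c d x : cell c x -> cell d x -> c = d.
Proof.
move=> cx dx; apply: eq_from_tnth => i; apply/val_inj/eqP.
have := cx i; have := dx i; rewrite /= !in_itv /= => /andP[d1 d2] /andP[c1 c2].
have := le_lt_trans d1 c2; have := le_lt_trans c1 d2.
by rewrite !ltNge !node_le -!ltnNge !ltnS eqn_leq => -> ->.
Qed.

Lemma trivIset_cell D : trivIset D cell.
Proof. by move=> c d _ _ [x [/cell_inj]]; exact. Qed.

Lemma cellsP P x : cells P x <-> exists2 c, c \in P & cell c x.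
Proof.
rewrite /cells -bigcup_seq; split => [[c /=]|[c cP cx]].
  by rewrite mem_enum; exists c.
by exists c => //=; rewrite mem_enum.
Qed.

Lemma measurable_cells P : measurable (cells P).
Proof. by apply: bigsetU_measurable => c _; exact: measurable_half_open_box. Qed.

Lemma integral_cells P (f : Rn R N -> \bar R) :
  measurable_fun [set: Rn R N] f -> (forall x, 0 <= f x) ->
  \int[lebesgue N]_(x in cells P) f x =
  \sum_(c in P) \int[lebesgue N]_(x in cell c) f x.
Proof.
move=> mf f0; rewrite ge0_integral_bigsetU ?big_enum//.
- by move=> c; exact: measurable_half_open_box.
- exact: enum_uniq.
- exact: trivIset_cell.
- exact: measurable_funS mf.
Qed.

Lemma lebesgue_cells P : lebesgue N (cells P) = (#|P|%:R * h ^+ N)%:E.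
Proof.
rewrite -[LHS]mul1e -integral_cst//; last exact: measurable_cells.
rewrite integral_cells// (eq_bigr (fun=> (h ^+ N)%:E)).
  by rewrite sumEFin sumr_const mulr_natl.
move=> c _; rewrite integral_cst ?mul1e ?lebesgue_cell//.
exact: measurable_half_open_box.
Qed.

(** The index of the cell of [x] in each coordinate is the integral part of
    [(x - o) / h]. *)
Lemma grid_box_cells Q : grid_box Q = cells (in_grid_box Q).
Proof.
apply/seteqP; split => x.
  move=> Qx; apply/cellsP.
  have /choice[k kP] (i : 'I_N) : exists k : 'I_M,
      between (tnth Q i) k /\ `[node k, node k.+1[%classic (tnth (x : N.-tuple R) i).
    have := Qx i; rewrite /= in_itv /=; set y := tnth (x : N.-tuple R) i => /andP[y1 y2].
    have yo : (0 <= (y - o) / h)%R.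
      by rewrite divr_ge0 ?(ltW h0)// subr_ge0 (le_trans _ y1)// /node lerDl mulr_ge0// ltW.
    pose k := Num.truncn ((y - o) / h).
    have ky : (node k <= y < node k.+1)%R.
      have := truncn_itv yo; rewrite ler_pdivlMr// ltr_pdivrMr// /node.
      by rewrite -/k => /andP[? ?]; apply/andP; split; lra.
    have /andP[ky1 ky2] := ky.
    have kb : (k < (tnth Q i).2)%N.
      by rewrite ltnNge -node_le -ltNge (le_lt_trans ky1).
    have ka : ((tnth Q i).1 <= k)%N.
      by rewrite -ltnS ltnNge -node_le -ltNge (le_lt_trans y1).
    have kM : (k < M)%N by rewrite (leq_trans kb)// -ltnS ltn_ord.
    by exists (Ordinal kM); rewrite /between /= ka kb in_itv.
  exists [tuple k i | i < N].
    by apply/in_grid_boxP => i; rewrite tnth_mktuple; have [] := kP i.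
  by move=> i; rewrite tnth_mktuple; have [] := kP i.
move=> /cellsP[c /in_grid_boxP cQ cx] i.
have := cx i; have /andP[ac cb] := cQ i; rewrite /= !in_itv /= => /andP[c1 c2].
by rewrite (le_trans _ c1) ?node_le//= (lt_le_trans c2)// node_le.
Qed.

End grids.

(** * From averages to the function *)

Definition orlicz {R : realType} n (u : R) : R := u * (1 + logp u) ^+ n.

Section orlicz_functions.
Context {R : realType}.
Implicit Types u v : R.

Lemma orlicz_factor_ge0 n u : 0 <= (1 + logp u) ^+ n.
Proof. by rewrite exprn_ge0// addr_ge0// logp_ge0. Qed.

Lemma orlicz_ge0 n u : 0 <= u -> 0 <= orlicz n u.
Proof. by move=> u0; rewrite mulr_ge0// orlicz_factor_ge0. Qed.

Lemma orlicz_geid n u : 0 <= u -> u <= orlicz n u.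
Proof.
by move=> u0; rewrite ler_peMr// exprn_ege1// lerDl logp_ge0.
Qed.

Lemma orlicz_scale n k u : 0 <= u ->
  orlicz n (2 ^+ k * u) <= 2 ^+ k * (k%:R + 1) ^+ n * orlicz n u.
Proof.
move=> u0; rewrite /orlicz.
rewrite [leRHS](_ : _ = 2 ^+ k * u * ((k%:R + 1) * (1 + logp u)) ^+ n); last first.
  by rewrite exprMn; ring.
rewrite ler_wpM2l ?mulr_ge0 ?exprn_ge0//.
have := logp_ge0 u; have := logp_ge0 (2 ^+ k * u); have := logp_exp2M k u0.
have : 0 <= k%:R :> R by [].
move=> k0 h l1 l2; rewrite lerXn2r ?nnegrE//; nra.
Qed.

(** The line through the origin lying below [orlicz n] up to a constant: a
    substitute for the tangent line at [v], and hence for Jensen's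
    inequality. *)
Lemma orlicz_above_line n u v : 0 <= u -> 0 <= v ->
  (1 + logp v) ^+ n * u <= orlicz n u + (1 + logp v) ^+ n * v.
Proof.
move=> u0 v0; have K0 := orlicz_factor_ge0 n v; have [uv|vu] := leP u v.
  by rewrite ler_wpDl ?orlicz_ge0// ler_wpM2l.
rewrite ler_wpDr ?mulr_ge0// /orlicz mulrC ler_wpM2l//.
rewrite lerXn2r ?nnegrE ?addr_ge0 ?logp_ge0// lerD2l.
by apply: le_logp => //; exact: ltW.
Qed.

(** Halving the argument of the logarithm costs a factor [2 ^+ n]. *)
Lemma orlicz_half n v : 0 <= v ->
  orlicz n v <= 2 ^+ n * ((1 + logp (v / 2)) ^+ n * v).
Proof.
move=> v0; rewrite /orlicz mulrA mulrC ler_wpM2r// -exprMn.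
have vE : v = 2 ^+ 1 * (v / 2) by rewrite expr1; field.
have v20 : 0 <= v / 2 by lra.
have := logp_exp2M 1 v20; rewrite -vE.
have := logp_ge0 v; have := logp_ge0 (v / 2) => l1 l2 l3.
rewrite lerXn2r ?nnegrE//; lra.
Qed.

Lemma measurable_orlicz n : measurable_fun [set: R] (orlicz n).
Proof.
apply: measurable_funM => //; apply: measurable_funX.
by apply: measurable_funD => //; exact: measurable_logp.
Qed.

Lemma orlicz_trunc_le A n u : 0 <= A -> 0 <= u ->
  orlicz_trunc A n u <= A * orlicz n u.
Proof.
move=> A0 u0; rewrite /orlicz_trunc; case: ifP => // _.
by rewrite mulr_ge0// orlicz_ge0.
Qed.

End orlicz_functions.

Section jensen.
Local Open Scope ereal_scope.
Context d (T : measurableType d) {R : realType}.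
Variable mu : {measure set T -> \bar R}.

(** Jensen's inequality up to the constant [2 ^+ n.+1], from the line of
    [orlicz_above_line] at half of the average [v]: the loss
    [K * (v / 2)] is then half of the gain [K * v]. *)
Lemma orlicz_jensen n (D : set T) (F : T -> R) (m v : R) : measurable D ->
  measurable_fun [set: T] F -> (forall x, 0 <= F x)%R ->
  (0 <= m)%R -> mu D = m%:E -> (0 <= v)%R ->
  \int[mu]_(x in D) (F x)%:E = (m * v)%:E ->
  (m * orlicz n v)%:E <=
    (2 ^+ n.+1)%:E * \int[mu]_(x in D) (orlicz n (F x))%:E.
Proof.
move=> mD mF F0 m0 muD v0 intF.
pose K := ((1 + logp (v / 2)) ^+ n)%R.
have K0 : (0 <= K)%R by exact: orlicz_factor_ge0.
have v20 : (0 <= v / 2)%R by lra.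
have mFD : measurable_fun D F by exact: measurable_funS mF.
have mo : measurable_fun D (fun x => (orlicz n (F x))%:E).
  apply/measurable_EFinP.
  exact: (measurableT_comp (measurable_orlicz n) mFD).
set I := \int[mu]_(x in D) (orlicz n (F x))%:E.
have I0 : 0 <= I.
  by apply: integral_ge0 => x _; rewrite lee_fin orlicz_ge0.
have key : (K * (m * v))%:E <= I + (K * (v / 2) * m)%:E.
  rewrite EFinM -intF -ge0_integralZl//; last 2 first.
  - exact/measurable_EFinP.
  - by move=> x _; rewrite lee_fin.
  have -> : (K * (v / 2) * m)%:E = \int[mu]_(x in D) (K * (v / 2))%:E.
    by rewrite integral_cst// EFinM -muD.
  rewrite -ge0_integralD//; last 2 first.
  - by move=> x _; rewrite lee_fin orlicz_ge0.
  - by move=> x _; rewrite lee_fin mulr_ge0.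
  apply: ge0_le_integral => //.
  - by move=> x _; rewrite -EFinM lee_fin mulr_ge0.
  - by apply: measurable_funeM; exact/measurable_EFinP.
  - exact: emeasurable_funD.
  - by move=> x _; rewrite -EFinM -EFinD lee_fin orlicz_above_line.
have := orlicz_half n v0; rewrite -/K => half.
case: (I) I0 key => [r r0 key|_ _|//]; last first.
  by rewrite mulry gtr0_sg ?exprn_gt0// mul1e leey.
rewrite lee_fin in r0; rewrite -EFinD lee_fin in key; rewrite -EFinM lee_fin.
rewrite exprS; apply: le_trans (ler_wpM2l m0 half) _.
have e0 : (0 <= 2 ^+ n :> R)%R by rewrite exprn_ge0.
have := ler_wpM2l e0 key.
set e := (2 ^+ n)%R; lra.
Qed.

Lemma le_integral_orlicz n (D : set T) (F : T -> R) : measurable D ->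
  measurable_fun [set: T] F -> (forall x, 0 <= F x)%R ->
  \int[mu]_(x in D) (F x)%:E <= \int[mu]_(x in D) (orlicz n (F x))%:E.
Proof.
move=> mD mF F0; have mFD : measurable_fun D F by exact: measurable_funS mF.
apply: ge0_le_integral => //.
- by move=> x _; rewrite lee_fin.
- exact/measurable_EFinP.
- apply/measurable_EFinP.
  exact: (measurableT_comp (measurable_orlicz n) mFD).
- by move=> x _; rewrite lee_fin orlicz_geid.
Qed.

Lemma ge0_integral_divr (D : set T) (F : T -> R) (b : R) : measurable D ->
  measurable_fun [set: T] F -> (forall x, 0 <= F x)%R -> (0 < b)%R ->
  \int[mu]_(x in D) (F x / b)%:E = b^-1%:E * \int[mu]_(x in D) (F x)%:E.
Proof.
move=> mD mF F0 b0; have mFD : measurable_fun D F by exact: measurable_funS mF.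
rewrite -ge0_integralZl_EFin//.
- by apply: eq_integral => x _; rewrite mulrC EFinM.
- by move=> x _; rewrite lee_fin.
- exact/measurable_EFinP.
- by rewrite invr_ge0 ltW.
Qed.

End jensen.

(** * The weak type inequality on a grid *)

Section grid_estimate.
Local Open Scope ereal_scope.
Context {R : realType}.

(** The continuous problem on a grid is the discrete one for the averages of
    [f] over the cells; [orlicz_jensen] returns from the averages to [f]. *)
Lemma grid_box_weak_type n : exists2 C : R, (0 < C)%R &
  forall M (o h : R) (F : {pred n.+1.-tuple ('I_M.+1 * 'I_M.+1)})
    (f : Rn R n.+1 -> R) (b : R), (0 < h)%R -> (0 < b)%R ->
    measurable_fun [set: Rn R n.+1] f ->
    (forall Q, Q \in F -> b%:E * lebesgue n.+1 (grid_box o h Q) <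
       \int[lebesgue n.+1]_(x in grid_box o h Q) `|f x|%:E) ->
    lebesgue n.+1 (\bigcup_(Q in [set Q | Q \in F]) grid_box o h Q) <=
      C%:E * \int[lebesgue n.+1]_x (orlicz n (`|f x| / b))%:E.
Proof.
have [A A0 HA] := grid_weak_type R n.
exists (1 + 2 ^+ n.+1 * A)%R; first by rewrite ltr_pwDl// mulr_ge0// exprn_ge0.
move=> M o h F f b h0 b0 mf hF.
set mu := lebesgue n.+1.
have b0' : (0 <= b)%R by exact: ltW.
have mnf : measurable_fun [set: Rn R n.+1] (fun x => `|f x|%R).
  exact: (measurableT_comp (@normr_measurable R setT)).
have mF : measurable_fun [set: Rn R n.+1] (fun x => (`|f x| / b)%R).
  by apply: measurable_funM.
have F0 x : (0 <= `|f x| / b)%R by rewrite divr_ge0.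
have mo : measurable_fun [set: Rn R n.+1] (fun x => (orlicz n (`|f x| / b))%:E).
  apply/measurable_EFinP.
  exact: (measurableT_comp (measurable_orlicz n) mF).
have o0 x : 0 <= (orlicz n (`|f x| / b))%:E by rewrite lee_fin orlicz_ge0.
have mE : measurable_fun [set: Rn R n.+1] (fun x => (`|f x|)%:E).
  exact/measurable_EFinP.
have mFE : measurable_fun [set: Rn R n.+1] (fun x => (`|f x| / b)%:E).
  exact/measurable_EFinP.
set I := \int[mu]_x _.
have mc (c : n.+1.-tuple 'I_M) : measurable (cell o h c : set (Rn R n.+1)).
  by exact: measurable_half_open_box.
have sub (D : set (Rn R n.+1)) : measurable D ->
    \int[mu]_(x in D) (orlicz n (`|f x| / b))%:E <= I.
  by move=> mD; apply: ge0_subset_integral.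
have intb (c : n.+1.-tuple 'I_M) : \int[mu]_(x in cell o h c) (`|f x| / b)%:E =
    b^-1%:E * \int[mu]_(x in cell o h c) (`|f x|)%:E.
  exact: ge0_integral_divr.
(* If [f] is not integrable on some cell, the right-hand side is infinite. *)
have [[c cy]|fin] := pselect (exists c : n.+1.-tuple 'I_M,
    \int[mu]_(x in cell o h c) (`|f x|)%:E = +oo).
  suff -> : I = +oo.
    rewrite gt0_muley ?leey// lte_fin ltr_pwDl//.
    by rewrite mulr_ge0// exprn_ge0.
  have Isub := sub _ (mc c).
  apply/eqP; rewrite -leye_eq; apply: le_trans Isub.
  have <- : \int[mu]_(x in cell o h c) (`|f x| / b)%:E = +oo.
    by rewrite intb cy gt0_muley// lte_fin invr_gt0.
  exact: le_integral_orlicz.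
have hN : (0 < h ^+ n.+1)%R by rewrite exprn_gt0.
pose g (c : n.+1.-tuple 'I_M) := (fine (\int[mu]_(x in cell o h c) (`|f x|)%:E) / h ^+ n.+1)%R.
have gE c : \int[mu]_(x in cell o h c) (`|f x|)%:E = (h ^+ n.+1 * g c)%:E.
  rewrite /g mulrC divfK ?gt_eqF// fineK// ge0_fin_numE.
    by rewrite ltey; apply/eqP => cy; apply: fin; exists c.
  by apply: integral_ge0 => x _; rewrite lee_fin.
have g0 c : (0 <= g c)%R.
  rewrite divr_ge0 ?(ltW hN)// fine_ge0//.
  by apply: integral_ge0 => x _; rewrite lee_fin.
pose P := [pred c | [exists Q, (Q \in F) && in_grid_box Q c]].
have -> : \bigcup_(Q in [set Q | Q \in F]) grid_box o h Q = cells o h P.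
  apply/seteqP; split => x.
    move=> [Q QF]; rewrite grid_box_cells// => /cellsP[c cQ cx].
    by apply/cellsP; exists c => //; apply/existsP; exists Q; apply/andP.
  move=> /cellsP[c /existsP[Q /andP[QF cQ]] cx].
  by exists Q => //; rewrite grid_box_cells//; apply/cellsP; exists c.
rewrite lebesgue_cells//.
have PQ : (#|P|%:R <= \sum_c orlicz_trunc A n (g c / b) :> R)%R.
  apply: le_trans (HA M g b g0 b0); rewrite ler_nat.
  apply/subset_leq_card/fintype.subsetP => c; rewrite !inE => /existsP[Q /andP[QF cQ]].
  apply/existsP; exists Q; rewrite cQ /=.
  have := hF Q QF; rewrite grid_box_cells// lebesgue_cells// integral_cells//.
  rewrite (eq_bigr (fun c => (h ^+ n.+1 * g c)%:E)); last by move=> d _; rewrite gE.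
  rewrite sumEFin -EFinM lte_fin -mulr_sumr mulrC mulrAC mulrC ltr_pM2l//.
  by rewrite sum_subE subr_gt0.
apply: (@le_trans _ _ (\sum_(c : n.+1.-tuple 'I_M) ((2 ^+ n.+1 * A)%:E *
    \int[mu]_(x in cell o h c) (orlicz n (`|f x| / b))%:E))).
  apply: (@le_trans _ _ (\sum_c (h ^+ n.+1 * orlicz_trunc A n (g c / b))%:E)).
    by rewrite sumEFin lee_fin -mulr_sumr mulrC ler_pM2l.
  apply: lee_sum => c _.
  have v0 : (0 <= g c / b)%R by rewrite divr_ge0.
  apply: (@le_trans _ _ (A%:E * (h ^+ n.+1 * orlicz n (g c / b))%:E)).
    by rewrite -EFinM lee_fin mulrCA ler_pM2l// orlicz_trunc_le.
  rewrite (mulrC (2 ^+ _)%R) (EFinM A) -muleA; apply: lee_wpmul2l => //.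
  apply: (orlicz_jensen _ (mc c) mF F0 (ltW hN) (lebesgue_cell o h0 c) v0).
  by rewrite intb gE -EFinM; congr EFin; ring.
rewrite -ge0_sume_distrr; last first.
  by move=> c _; apply: integral_ge0 => x _; exact: o0.
rewrite -(integral_cells _ h0 predT)//.
apply: (@le_trans _ _ ((2 ^+ n.+1 * A)%:E * I)).
  rewrite lee_wpmul2l ?lee_fin ?mulr_ge0 ?exprn_ge0//.
  by apply: sub; exact: measurable_cells.
apply: lee_wpmul2r; first by apply: integral_ge0.
by rewrite lee_fin lerDr.
Qed.

End grid_estimate.

(** * Reduction to one grid *)

Lemma leq_bigmax2 (I : finType) (J : eqType) (l : seq J) (F : J -> I -> nat) j i :
  j \in l -> (F j i <= \max_(k <- l) \max_i F k i)%N.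
Proof.
move=> jl; apply: (@leq_trans (\max_i F j i)%N); first exact: leq_bigmax.
by rewrite (big_rem j jl) leq_maxl.
Qed.

Lemma measure_countable_bigcup_le d (T : measurableType d) (R : realType)
    (mu : {measure set T -> \bar R}) (I : countType) (F : I -> set T)
    (b : \bar R) : (forall i, measurable (F i)) ->
  (forall l : seq I, (mu (\bigcup_(i in [set` l]) F i) <= b)%E) ->
  (mu (\bigcup_i F i) <= b)%E.
Proof.
move=> mF hb.
pose D k := \bigcup_(i in [set` pmap (@unpickle I) (iota 0 k)]) F i.
have mD k : measurable (D k) by apply: fin_bigcup_measurable.
have DE : \bigcup_i F i = \bigcup_k D k.
  apply/seteqP; split => x [i _ Fi]; last by case: Fi => j _ Fj; exists j.
  exists (pickle i).+1 => //; exists i => //.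
  change (i \in pmap (@unpickle I) (iota 0 (pickle i).+1)).
  rewrite mem_pmap; apply/mapP; exists (pickle i); rewrite ?pickleK//.
  by rewrite mem_iota add0n ltnS leqnn.
have ndD : nondecreasing_seq D.
  move=> k l kl; apply/subsetPset => x [i /= hi Fi]; exists i => //=.
  move: hi; rewrite !mem_pmap => /mapP[j jk ij]; apply/mapP; exists j => //.
  by move: jk; rewrite !mem_iota !add0n /= => /leq_trans; apply.
rewrite DE.
have cD := @nondecreasing_cvg_mu _ _ _ mu _ mD (bigcupT_measurable _ mD) ndD.
rewrite -(cvg_lim _ cD)//; apply: lime_le; first by apply/cvg_ex; exists (mu (\bigcup_k D k)).
by apply: nearW => k; exact: hb.
Qed.

Section triple_boxes.
Context {R : realType}.

(** For [ms i = (m, s)]: the product of the intervals made of the dyadic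
    interval of length [2 ^ s] with left end [m * 2 ^ s] and its two
    neighbours. *)
Definition triple_box N (ms : {ffun 'I_N -> int * int}) : set (Rn R N) :=
  half_open_box (fun i => ((ms i).1 - 1)%:~R * 2 ^ (ms i).2)
                (fun i => ((ms i).1 + 2)%:~R * 2 ^ (ms i).2).

(** The mesh is [2 ^- L], where no exponent lies below [- L], and the origin is
    moved to the left of all the boxes so that the nodes have natural
    indices. *)
Lemma common_grid N (l : seq {ffun 'I_N -> int * int}) :
  exists M (o h : R) (q : {ffun 'I_N -> int * int} -> N.-tuple ('I_M.+1 * 'I_M.+1)),
    0 < h /\ forall ms, ms \in l -> grid_box o h (q ms) = triple_box ms.
Proof.
pose L := (\max_(ms <- l) \max_i absz (ms i).2)%N.
pose e (ms : {ffun 'I_N -> int * int}) i := absz ((ms i).2 + L%:Z).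
pose end1 (ms : {ffun 'I_N -> int * int}) i : int := ((ms i).1 - 1) * 2 ^+ e ms i.
pose end2 (ms : {ffun 'I_N -> int * int}) i : int := ((ms i).1 + 2) * 2 ^+ e ms i.
pose K := (\max_(ms <- l) \max_i maxn (absz (end1 ms i)) (absz (end2 ms i)))%N.
pose h : R := 2 ^- L.
pose q (ms : {ffun 'I_N -> int * int}) : N.-tuple ('I_(K + K).+1 * 'I_(K + K).+1) :=
  [tuple (inord (absz (end1 ms i + K%:Z)), inord (absz (end2 ms i + K%:Z))) | i < N].
exists (K + K)%N, (- (K%:R * h)), h, q; split; first by rewrite invr_gt0 exprn_gt0.
move=> ms msl.
have sL i : (absz (ms i).2 <= L)%N.
  exact: (@leq_bigmax2 _ _ _ (fun (ms : {ffun 'I_N -> int * int}) i => absz (ms i).2)).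
have sK i : (maxn (absz (end1 ms i)) (absz (end2 ms i)) <= K)%N.
  exact: (@leq_bigmax2 _ _ _ (fun (ms : {ffun 'I_N -> int * int}) i =>
    maxn (absz (end1 ms i)) (absz (end2 ms i)))).
have pow i : 2 ^+ e ms i * h = 2 ^ (ms i).2 :> R.
  have -> : (ms i).2 = (e ms i)%:Z - L%:Z 
    by rewrite /e; move: (ms i).2 (sL i) => s; clearbody L; lia.
  by rewrite expfzDr ?pnatr_eq0// -exprnP /h exprnN.
have nodeE (z : int) : (absz z <= K)%N ->
    node (- (K%:R * h)) h (@inord (K + K) (absz (z + K%:Z))) = z%:~R * h.
  move=> zK; rewrite /node inordK; last by lia.
  have -> : (absz (z + K%:Z))%:R = z%:~R + K%:R :> R.
    by rewrite natr_absz ger0_norm ?intrD//; clearbody K; lia.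
  by ring.
rewrite /grid_box /triple_box; congr half_open_box; apply/funext => i.
  rewrite tnth_mktuple /= nodeE; last by have := sK i; lia.
  by rewrite -pow /end1 intrM -mulrA rmorphXn.
rewrite tnth_mktuple /= nodeE; last by have := sK i; lia.
by rewrite -pow /end2 intrM -mulrA rmorphXn.
Qed.

End triple_boxes.

(** * The weak type inequality for dyadic side lengths *)

Lemma subset_integral_norm d (T : measurableType d) (R : realType)
    (mu : {measure set T -> \bar R}) (A B : set T) (f : T -> R) :
  measurable A -> measurable B -> measurable_fun [set: T] f -> A `<=` B ->
  (\int[mu]_(x in A) `|f x|%:E <= \int[mu]_(x in B) `|f x|%:E)%E.
Proof.
move=> mA mB mf AB; apply: ge0_subset_integral => //.
apply/measurable_EFinP; apply: (@measurable_funS _ _ _ _ setT) => //.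
exact: (measurableT_comp (@normr_measurable R setT)).
Qed.

Lemma integral_orlicz_scale d (T : measurableType d) (R : realType)
    (mu : {measure set T -> \bar R}) n k (f : T -> R) (a : R) :
  measurable_fun [set: T] f -> 0 < a ->
  (\int[mu]_x (orlicz n (`|f x| / (a / 2 ^+ k)))%:E <=
    (2 ^+ k * (k%:R + 1) ^+ n)%:E * \int[mu]_x (orlicz n (`|f x| / a))%:E)%E.
Proof.
move=> mf a0.
have mnf : measurable_fun [set: T] (fun x => `|f x|).
  exact: (measurableT_comp (@normr_measurable R setT)).
have F0 (c : R) x : 0 < c -> 0 <= `|f x| / c.
  by move=> c0; rewrite divr_ge0 ?(ltW c0).
have mo (c : R) : measurable_fun [set: T] (fun x => (orlicz n (`|f x| / c))%:E).
  apply/measurable_EFinP; apply: (measurableT_comp (measurable_orlicz n)).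
  exact: measurable_funM.
rewrite -ge0_integralZl_EFin//; last first.
  by move=> x _; rewrite lee_fin orlicz_ge0// F0.
apply: ge0_le_integral => //.
- by move=> x _; rewrite lee_fin orlicz_ge0// F0// divr_gt0// exprn_gt0.
- by apply: measurable_funeM; exact: mo.
- move=> x _; rewrite -EFinM lee_fin.
  have -> : `|f x| / (a / 2 ^+ k) = 2 ^+ k * (`|f x| / a).
    by rewrite invfM invrK; ring.
  by apply: orlicz_scale; exact: F0.
Qed.

Section weak_type.
Local Open Scope ereal_scope.
Context {R : realType}.

Definition dyadic_box N : set (set (Rn R N)) :=
  [set Q | exists I : 'I_N -> set R,
    [/\ interval_sides I, Q = box I & forall i, dyadic (len (I i))]].

Lemma interval_side_measure N (I : 'I_N -> set R) i : interval_sides I ->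
  [/\ measurable (I i : set (measurableTypeR R)),
      lebesgue_measure (I i) = (len (I i))%:E & (0 < len (I i))%R].
Proof.
move=> /(_ i) [itvI /andP[I0 Ioo]].
have E : lebesgue_measure (I i) = (len (I i))%:E.
  by rewrite /len fineK// ge0_fin_numE ?ltW.
split=> //; first exact: is_interval_measurable.
by rewrite -lte_fin -E.
Qed.

Lemma interval_side_dist N (I : 'I_N -> set R) i x y : interval_sides I ->
  I i x -> I i y -> (y <= x + len (I i))%R.
Proof.
move=> sI Ix Iy; have [mI IE I0] := interval_side_measure i sI.
have [xy|/ltW yx] := leP x y; last by rewrite (le_trans yx)// lerDl ltW.
rewrite -lerBlDl -lee_fin -IE.
have -> : (y - x)%:E = lebesgue_measure (`[x, y]%classic : set R).
  rewrite lebesgue_measure_itv /= lte_fin; case: ltP => [_|yx]; first by rewrite EFinB.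
  by rewrite (@le_anti _ _ x y) ?xy// subrr.
apply: le_measure; [by rewrite inE; exact: measurable_itv|by rewrite inE|].
move=> z /=; rewrite in_itv /= => zxy; exact: (sI i).1 Ix Iy z zxy.
Qed.

Lemma lebesgue_triple_box N (ms : {ffun 'I_N -> int * int}) :
  lebesgue N (triple_box ms : set (Rn R N)) = (3 ^+ N * \prod_i 2 ^ (ms i).2)%:E.
Proof.
have e0 (s : int) : (0 < 2 ^ s :> R)%R by rewrite exprz_gt0.
rewrite lebesgue_half_open_box; last first.
  by move=> i; rewrite ltr_pM2r// ltr_int; lia.
congr EFin.
rewrite -[X in (3 ^+ X)%R](card_ord N) -prodr_const -big_split /=.
apply: eq_bigr => i _; rewrite -mulrBl; congr (_ * _)%R.
by rewrite intrB intrD; ring.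
Qed.

(** [m] is the integral part of [x / 2 ^ s] in each coordinate; any interval of
    length [2 ^ s] through [x] then stays within the neighbours of the dyadic
    interval of [x]. *)
Lemma dyadic_box_triple N (Q : set (Rn R N)) x : dyadic_box Q -> Q x ->
  exists (ms : {ffun 'I_N -> int * int}) (r : R),
  [/\ (0 < r)%R, measurable Q, lebesgue N Q = r%:E, Q `<=` triple_box ms &
      lebesgue N (triple_box ms : set (Rn R N)) = (3 ^+ N * r)%:E].
Proof.
move=> [I [sI -> dI]] Qx.
have /choice[s sE] : forall i, exists s : int, len (I i) = (2 ^ s)%R.
  by move=> i; have [s _ <-] := dI i; exists s.
have e0 (t : int) : (0 < 2 ^ t :> R)%R by rewrite exprz_gt0.
pose u i := tnth (x : N.-tuple R) i.
exists [ffun i => (Num.floor (u i / 2 ^ s i)%R, s i)], (\prod_i 2 ^ s i)%R.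
have mI i := interval_side_measure i sI.
split.
- by apply: prodr_gt0 => i _.
- by apply: measurable_box => i; have [] := mI i.
- by apply: lebesgue_box => i; have [? E _] := mI i; rewrite ?E ?sE.
- move=> y Qy i; rewrite /= ffunE /= in_itv /=.
  have := interval_side_dist sI (Qx i) (Qy i).
  have := interval_side_dist sI (Qy i) (Qx i).
  rewrite sE -/(u i); set v := tnth _ i => uv vu.
  have /andP[f1 f2] := floor_itv (u i / 2 ^ s i)%R.
  move: f1 f2; rewrite ler_pdivlMr// ltr_pdivrMr//.
  rewrite !intrD rmorphN /= => f1 f2; apply/andP; split; lra.
- rewrite lebesgue_triple_box; congr (_ * _)%:E.
  by apply: eq_bigr => i _; rewrite ffunE.
Qed.

Theorem dyadic_box_weak_type n : exists C : R,
  forall B : set (set (Rn R n.+1)), B `<=` @dyadic_box n.+1 ->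
    weak_type_estimate B (fun u => u * (1 + logp u) ^+ n)%R C.
Proof.
have [C C0 HC] := grid_box_weak_type (R := R) n.
(* [2 ^+ k = 4 ^+ n.+1] is a power of two above the loss [3 ^+ n.+1]. *)
pose k := (2 * n.+1)%N.
exists (C * (2 ^+ k * (k%:R + 1) ^+ n))%R => B dB f a mf a0.
pose b : R := (a / 2 ^+ k)%R.
have b0 : (0 < b)%R by rewrite divr_gt0// exprn_gt0.
set mu := lebesgue n.+1.
have mnf : measurable_fun [set: Rn R n.+1] (fun x => `|f x|%R).
  exact: (measurableT_comp (@normr_measurable R setT)).
have mE : measurable_fun [set: Rn R n.+1] (fun x => (`|f x|)%:E).
  exact/measurable_EFinP.
have mt (ms : {ffun 'I_n.+1 -> int * int}) : measurable (triple_box ms : set (Rn R n.+1)).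
  exact: measurable_half_open_box.
pose sel (ms : {ffun 'I_n.+1 -> int * int}) :=
  `[< b%:E * mu (triple_box ms) < \int[mu]_(x in triple_box ms) `|f x|%:E >].
pose S ms : set (Rn R n.+1) := if sel ms then triple_box ms else set0.
have cover : [set x | a%:E < maximal B f x] `<=` \bigcup_ms S ms.
  move=> x /= /ereal_sup_gt[_ [Q [BQ Qx] <-]] aQ.
  have [ms [r [r0 mQ Qr Qms msr]]] := dyadic_box_triple (dB _ BQ) Qx.
  exists ms => //; rewrite /S; suff -> : sel ms by exact: Qms.
  apply/asboolP; rewrite msr.
  have int_le : \int[mu]_(y in Q) `|f y|%:E <= \int[mu]_(y in triple_box ms) `|f y|%:E.
    exact: subset_integral_norm.
  apply: lt_le_trans int_le.
  move: aQ; rewrite Qr inver gt_eqF// => aQ.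
  apply: (@le_lt_trans _ _ (a * r)%:E).
    rewrite -EFinM lee_fin /b mulrA ler_pM2r// -mulrA ger_pMr//.
    rewrite mulrC ler_pdivrMr ?exprn_gt0// mul1r /k exprM.
    by rewrite lerXn2r ?nnegrE//; lra.
  by rewrite mulrC EFinM -lte_pdivlMl.
have bound : mu (\bigcup_ms S ms) <=
    C%:E * \int[mu]_x (orlicz n (`|f x| / b))%:E.
  apply: measure_countable_bigcup_le => [ms|l].
    by rewrite /S; case: ifP.
  have [M [z [h [q [h0 hq]]]]] := common_grid (R := R) l.
  rewrite (_ : \bigcup_(i in [set` l]) S i =
     \bigcup_(Q in [set Q | Q \in [seq q ms | ms <- l & sel ms]]) grid_box z h Q).
    apply: HC => // Q /mapP[ms]; rewrite mem_filter => /andP[sms msl] ->.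
    by rewrite hq//; exact/asboolP.
  apply/seteqP; split => x.
    move=> [ms /= msl]; rewrite /S; case: ifP => // sms msx.
    exists (q ms); last by rewrite hq.
    by apply/mapP; exists ms => //; rewrite mem_filter sms.
  move=> [Q /= /mapP[ms]]; rewrite mem_filter => /andP[sms msl] ->.
  by rewrite hq// => msx; exists ms => //; rewrite /S sms.
apply: le_trans (le_lebesgue cover) _; apply: le_trans bound _.
rewrite EFinM -muleA lee_wpmul2l ?lee_fin ?(ltW C0)//.
exact: integral_orlicz_scale.
Qed.

End weak_type.

(** * Binary digits *)

Section binary_digits.
Implicit Types (K b e m q p : nat) (w : nat -> bool -> bool).
Local Open Scope nat_scope.

Definition bit p m := odd (m %/ 2 ^ p).

(** [w p c] tells whether the digit [c] is allowed at the position [p]. *)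
Definition allowed K w m := all (fun p => w p (bit p m)) (iota 0 K).

(** The number of ways to fill the positions below [b]. *)
Definition choices w b := \prod_(p < b) (w p false + w p true).

Lemma allowedP K w m :
  reflect (forall p, p < K -> w p (bit p m)) (allowed K w m).
Proof.
apply: (iffP allP) => h p; last by rewrite mem_iota => /andP[_]; exact: h.
by move=> pK; apply: h; rewrite mem_iota.
Qed.

Lemma half_div b m (c : bool) : (c + m.*2) %/ 2 ^ b.+1 = m %/ 2 ^ b.
Proof.
by rewrite expnS divnMA divn2 half_bit_double.
Qed.

Lemma bitS p m (c : bool) : bit p.+1 (c + m.*2) = bit p m.
Proof. by rewrite /bit half_div. Qed.

Lemma bit0 m (c : bool) : bit 0 (c + m.*2) = c.
Proof. by rewrite /bit divn1 oddD odd_double addbF oddb. Qed.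

Lemma allowedS K w m (c : bool) :
  allowed K.+1 w (c + m.*2) = w 0 c && allowed K (w \o succn) m.
Proof.
rewrite /allowed /= bit0 -[1]/(1 + 0) iotaDl all_map; congr (_ && _).
by apply: eq_all => p /=; rewrite add1n bitS.
Qed.

Lemma sum_double (F : nat -> nat) k :
  \sum_(m < k.*2) F m = \sum_(m < k) (F (false + m.*2) + F (true + m.*2)).
Proof.
elim: k => [|k IH]; first by rewrite !big_ord0.
by rewrite doubleS !big_ord_recr /= IH -addnA.
Qed.

(** The numbers of the block [q] of length [2 ^ b] share their digits from the
    position [b] on, and their lower digits are free. The induction on [b] peels
    off the lowest digit. *)
Lemma block_count b e w q : q < 2 ^ e ->
  \sum_(m < 2 ^ (b + e)) ((m %/ 2 ^ b == q) && allowed (b + e) w m : nat) =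
  choices w b * allowed e (fun p => w (p + b)) q.
Proof.
elim: b w => [|b IH] w qe.
  rewrite add0n /choices big_ord0 mul1n (bigD1 (Ordinal qe))//= divn1 eqxx /=.
  rewrite big1 ?addn0 => [|i]; last first.
    by rewrite -val_eqE /= divn1 => /negbTE ->.
  by congr nat_of_bool; apply: eq_all => p; rewrite addn0.
rewrite addSn (expnS 2 (b + e)) mul2n.
rewrite (sum_double (fun m => (m %/ 2 ^ b.+1 == q) && allowed (b + e).+1 w m)).
transitivity (\sum_(m < 2 ^ (b + e)) (w 0 false + w 0 true) *
    ((m %/ 2 ^ b == q) && allowed (b + e) (w \o succn) m)).
  apply: eq_bigr => m _; rewrite !half_div !allowedS.
  by case: (_ == q); case: (w 0 false); case: (w 0 true); case: (allowed _ _ _).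
rewrite -big_distrr /= IH// mulnA; congr (_ * _).
  by rewrite /choices big_ord_recl.
by congr nat_of_bool; apply: eq_all => p /=; rewrite addnS.
Qed.

(** Each constrained position below [b] halves the number of choices. *)
Lemma choices_constraints w (D : seq nat) b : uniq D ->
  (forall p, w p false + w p true = if p \in D then 1 else 2) ->
  2 ^ count (ltn^~ b) D * choices w b = 2 ^ b.
Proof.
move=> uD wD; elim: b => [|b IH].
  by rewrite /choices big_ord0 muln1 (eq_count (a2 := pred0)) ?count_pred0.
rewrite /choices big_ord_recr /= -/(choices w b).
have -> : count (ltn^~ b.+1) D = count (ltn^~ b) D + (b \in D).
  rewrite -(count_uniq_mem b uD) -count_predUI [X in _ + X](_ : _ = 0).
    by rewrite addn0; apply: eq_count => d /=; rewrite ltnS leq_eqVlt orbC.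
  rewrite (eq_count (a2 := pred0)) ?count_pred0// => d /=.
  by apply/andP => -[db /eqP dE]; rewrite dE ltnn in db.
rewrite expnD mulnACA IH wD expnS mulnC; congr (_ * _).
by case: ifP.
Qed.

End binary_digits.

(** * Sets defined by binary digits on the line *)

Section digit_sets.
Context {R : realType}.
Variables (h : R).
Hypothesis h0 : 0 < h.

Definition grid_set k (P : pred nat) : set R :=
  \big[setU/set0]_(m < k | P m) `[m%:R * h, m.+1%:R * h[%classic.

Lemma grid_setP k P x : grid_set k P x <->
  exists m, [/\ (m < k)%N, P m & m%:R * h <= x < m.+1%:R * h].
Proof.
rewrite /grid_set -bigcup_seq_cond; split=> [[m /= /andP[_ Pm]]|[m [mk Pm mx]]].
  by rewrite in_itv /= => mx; exists m; split.
by exists (Ordinal mk); rewrite /= ?mem_index_enum// in_itv.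
Qed.

Lemma measurable_grid_set k P : measurable (grid_set k P : set (measurableTypeR R)).
Proof. by apply: bigsetU_measurable => m _; exact: measurable_itv. Qed.

Lemma grid_cell_inj m m' x : m%:R * h <= x < m.+1%:R * h ->
  m'%:R * h <= x < m'.+1%:R * h -> m = m'.
Proof.
move=> /andP[a b] /andP[c d]; have := le_lt_trans a d; have := le_lt_trans c b.
by rewrite !ltr_pM2r// !ltr_nat !ltnS => x1 x2; apply/eqP; rewrite eqn_leq x1 x2.
Qed.

Lemma lebesgue_grid_set k (P : pred nat) :
  lebesgue_measure (grid_set k P) = ((\sum_(m < k) P m)%N%:R * h)%:E.
Proof.
rewrite /grid_set measure_bigsetU_ord_cond //=; last first.
  move=> m m' _ _ [x [/=]]; rewrite !in_itv /= => mx m'x.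
  exact/val_inj/(grid_cell_inj mx m'x).
rewrite natr_sum mulr_suml -sumEFin big_mkcond /=.
apply: eq_bigr => m _; case: (P m); last by rewrite mul0r.
rewrite lebesgue_measure_itv /= lte_fin ltr_pM2r// ltr_nat ltnSn.
by rewrite -EFinB -natr1; congr EFin; ring.
Qed.

(** From the position [b] on, the digits allowed by [w'] are allowed by [w], so
    all the numbers of the block of length [2 ^ b] around a point of the set
    of [w'] have allowed digits there; at the positions below [b], [r] of which
    are constrained, the proportion [2 ^- r] of the block is allowed. *)
Lemma digit_block K b r (w w' : nat -> bool -> bool) x : (b <= K)%N ->
  (2 ^ r * choices w b = 2 ^ b)%N ->
  (forall p c, (b <= p)%N -> w' p c -> w p c) ->
  grid_set (2 ^ K) (allowed K w') x ->
  exists q : nat, [/\ (q * 2 ^ b)%N%:R * h <= x < (q.+1 * 2 ^ b)%N%:R * h &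
   exists J : set R, [/\ measurable (J : set (measurableTypeR R)),
     J `<=` grid_set (2 ^ K) (allowed K w),
     J `<=` `[(q * 2 ^ b)%N%:R * h, (q.+1 * 2 ^ b)%N%:R * h[%classic &
     lebesgue_measure J = (2 ^- r * (2 ^+ b * h))%:E]].
Proof.
move=> bK hr ww' /grid_setP[m [mK /allowedP mw' mx]].
pose q := (m %/ 2 ^ b)%N.
have blk m' : (m' %/ 2 ^ b = q)%N -> ((q * 2 ^ b <= m') && (m'.+1 <= q.+1 * 2 ^ b))%N.
  by move=> <-; rewrite leq_divM -ltn_divLR ?expn_gt0//= ltnSn.
have sub m' y : (m' %/ 2 ^ b = q)%N -> m'%:R * h <= y < m'.+1%:R * h ->
    (q * 2 ^ b)%N%:R * h <= y < (q.+1 * 2 ^ b)%N%:R * h.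
  move=> /blk /andP[b1 b2] /andP[y1 y2].
  rewrite (le_trans _ y1) ?ler_pM2r ?ler_nat//=.
  by rewrite (lt_le_trans y2)// ler_pM2r// ler_nat.
exists q; split; first exact: sub mx.
exists (grid_set (2 ^ K) (fun m' => (m' %/ 2 ^ b == q)%N && allowed K w m')).
split; first exact: measurable_grid_set.
- move=> y /grid_setP[m' [m'K /andP[_ m'w] m'y]].
  by apply/grid_setP; exists m'.
- move=> y /grid_setP[m' [m'K /andP[/eqP m'q _] m'y]].
  by rewrite /= in_itv /=; exact: sub m'y.
rewrite lebesgue_grid_set; congr EFin; rewrite mulrA; congr (_ * _).
have KE : K = (b + (K - b))%N by rewrite subnKC.
have qK : (q < 2 ^ (K - b))%N.
  by rewrite /q ltn_divLR ?expn_gt0// -expnD addnC -KE.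
have bc := block_count b w qK; rewrite -KE in bc; rewrite {}bc.
have -> : allowed (K - b) (fun p => w (p + b)%N) q.
  apply/allowedP => p pK; apply: ww'; first exact: leq_addl.
  have -> : bit p q = bit (p + b) m.
    by rewrite /bit /q -divnMA -expnD addnC.
  by apply: mw'; lia.
rewrite muln1; apply: (@mulfI _ (2 ^+ r)); first by rewrite gt_eqF ?exprn_gt0.
by rewrite mulrA divff ?gt_eqF ?exprn_gt0// mul1r -!natrX -natrM hr.
Qed.

End digit_sets.

(** * Products of digit sets *)

Lemma integral_phi_indic d (T : measurableType d) (R : realType)
    (mu : {measure set T -> \bar R}) (E : set T) (phi : R -> R) (a : R) :
  measurable E -> phi 0 = 0 -> 0 <= phi a^-1 ->
  (\int[mu]_x (phi (`|\1_E x| / a))%:E = (phi a^-1)%:E * mu E)%E.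
Proof.
move=> mE phi0 phia; rewrite -[in RHS](setIT E) -integral_indic//.
rewrite -ge0_integralZl_EFin//.
  apply: eq_integral => x _; rewrite indicE.
  by case: (x \in E); rewrite ?normr1 ?mul1r ?mule1// normr0 mul0r phi0 mule0.
by apply/measurable_EFinP; exact: measurable_indic.
Qed.

Section product_digit_sets.
Context {R : realType}.
Variables (N K : nat) (h : R).
Hypothesis h0 : 0 < h.
Implicit Types w : 'I_N -> nat -> bool -> bool.

Definition digit_box w : set (Rn R N) :=
  box (fun i => grid_set h (2 ^ K) (allowed K (w i))).

Lemma measurable_digit_box w : measurable (digit_box w).
Proof. by apply: measurable_box => i; exact: measurable_grid_set. Qed.

Lemma sum_allowed (u : nat -> bool -> bool) :
  (\sum_(m < 2 ^ K) allowed K u m)%N = choices u K.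
Proof.
have := @block_count K 0 u 0 isT; rewrite addn0 muln1 => <-.
by apply: eq_bigr => m _; rewrite divn_small ?ltn_ord.
Qed.

Lemma lebesgue_digit_box w (r : 'I_N -> nat) :
  (forall i, 2 ^ r i * choices (w i) K = 2 ^ K)%N ->
  lebesgue N (digit_box w) =
    (2 ^- (\sum_i r i)%N * (2 ^+ K * h) ^+ N)%:E.
Proof.
move=> hr; rewrite (lebesgue_box (l := fun i => 2 ^- r i * (2 ^+ K * h))).
- rewrite big_split /= prodr_const card_ord; congr (_ * _)%:E.
  by rewrite -prodrXr prodfV.
- by move=> i; exact: measurable_grid_set.
- move=> i; rewrite lebesgue_grid_set// sum_allowed; congr EFin.
  rewrite mulrA; congr (_ * _); apply: (@mulfI _ (2 ^+ r i)).
    by rewrite gt_eqF ?exprn_gt0.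
  by rewrite mulrA divff ?gt_eqF ?exprn_gt0// mul1r -!natrX -natrM hr.
Qed.

(** The box of sides [2 ^ b i * h] around a point of [digit_box w'] meets
    [digit_box w] in a proportion of [2 ^- k], by [digit_block] in each
    coordinate. *)
Lemma digit_box_average (B : set (set (Rn R N))) w w' (b r : 'I_N -> nat) k :
  (forall i, b i <= K)%N ->
  (forall i, 2 ^ r i * choices (w i) (b i) = 2 ^ b i)%N ->
  (\sum_i r i = k)%N ->
  (forall i p c, (b i <= p)%N -> w' i p c -> w i p c) ->
  (forall q : 'I_N -> nat,
     B (half_open_box (fun i => (q i * 2 ^ b i)%N%:R * h)
                      (fun i => ((q i).+1 * 2 ^ b i)%N%:R * h))) ->
  digit_box w' `<=`
    [set x | ((2 ^- k.+1)%:E < maximal B (\1_(digit_box w) : _ -> R) x)%E].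
Proof.
move=> bK hr hk ww' hB x xw'.
have /choice[q /all_and2[qx /choice[J /all_and4[mJ Jw Jq lJ]]]] :=
  fun i => digit_block h0 (bK i) (hr i) (@ww' i) (xw' i).
pose Q : set (Rn R N) := half_open_box (fun i => (q i * 2 ^ b i)%N%:R * h)
                      (fun i => ((q i).+1 * 2 ^ b i)%N%:R * h).
have mQ : measurable Q by exact: measurable_half_open_box.
have e0 j : (0 : R) < 2 ^+ j by rewrite exprn_gt0.
pose s := \prod_i (2 ^+ b i * h).
have s0 : 0 < s by apply: prodr_gt0 => i _; rewrite mulr_gt0.
have lQ : lebesgue N Q = s%:E.
  rewrite lebesgue_half_open_box => [|i].
    congr EFin; apply: eq_bigr => i _.
    by rewrite !natrM -natr1 natrX; ring.
  by rewrite ltr_pM2r// ltr_nat ltn_pmul2r ?expn_gt0.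
apply: (@lt_le_trans _ _ (2 ^- k)%:E).
  by rewrite lte_fin ltf_pV2 ?posrE// ltr_eXn2l ?ltr1n.
apply: le_trans (ereal_sup_ubound _); last first.
  exists Q; last by [].
  by split; [exact: hB|move=> i; rewrite /= in_itv /=; exact: qx].
rewrite lQ inver gt_eqF// lee_pdivlMl// -EFinM.
rewrite (eq_integral (fun y => (\1_(digit_box w) y)%:E)); last first.
  by move=> y _; rewrite ger0_norm// indicE.
rewrite integral_indic//; last exact: measurable_digit_box.
have -> : (s * 2 ^- k)%:E = lebesgue N (box J).
  rewrite (lebesgue_box mJ lJ) big_split /= mulrC; congr (_ * _)%:E.
  by rewrite -hk -prodrXr prodfV.
apply: le_lebesgue => y Jy; split => i; first exact: Jw.
exact: Jq.
Qed.

End product_digit_sets.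

(** If [phi] is a weak type function for [B], the family of pairwise disjoint
    sets [digit_box (v t)], on each of which the maximal function of the
    indicator of [digit_box w] exceeds [2 ^- k.+1], bounds [phi] from below. *)
Lemma digit_lower_bound (R : realType) (N : nat) (I : finType) (K k l : nat)
    (w : 'I_N -> nat -> bool -> bool) (v : I -> 'I_N -> nat -> bool -> bool)
    (b r s : I -> 'I_N -> nat) (e : 'I_N -> nat) (h : R)
    (B : set (set (Rn R N))) (phi : R -> R) (C : R) :
  0 < h ->
  (forall t i, b t i <= K)%N ->
  (forall t i, 2 ^ r t i * choices (w i) (b t i) = 2 ^ b t i)%N ->
  (forall t, \sum_i r t i = k)%N ->
  (forall t i, 2 ^ s t i * choices (v t i) K = 2 ^ K)%N ->
  (forall t, \sum_i s t i <= k + l)%N ->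
  (forall i, 2 ^ e i * choices (w i) K = 2 ^ K)%N ->
  (\sum_i e i = k + k)%N ->
  (forall t i p c, (b t i <= p)%N -> v t i p c -> w i p c) ->
  (forall t t', t != t' -> exists i p, (p < K)%N /\
     forall c, ~~ (v t i p c && v t' i p c)) ->
  (forall t (q : 'I_N -> nat),
     B (half_open_box (fun i => (q i * 2 ^ b t i)%N%:R * h)
                      (fun i => ((q i).+1 * 2 ^ b t i)%N%:R * h))) ->
  phi 0 = 0 -> 0 <= phi (2 ^+ k.+1) -> weak_type_estimate B phi C ->
  #|I|%:R * 2 ^+ k <= 2 ^+ l * C * phi (2 ^+ k.+1).
Proof.
move=> h0 bK hr rk hs sl he ek vw vdis hB phi0 phige0 wt.
pose E : set (Rn R N) := digit_box K h w.
have mE : measurable E by exact: measurable_digit_box.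
have p0 j : (0 : R) < 2 ^+ j by rewrite exprn_gt0.
pose X : R := (2 ^+ K * h) ^+ N.
have X0 : 0 < X by rewrite exprn_gt0// mulr_gt0.
have lE : lebesgue N E = (2 ^- (k + k) * X)%:E.
  by rewrite (lebesgue_digit_box h0 he) ek.
pose V t : set (Rn R N) := digit_box K h (v t).
have mV t : measurable (V t) by exact: measurable_digit_box.
have lV t : lebesgue N (V t) = (2 ^- (\sum_i s t i)%N * X)%:E.
  exact: lebesgue_digit_box.
have disV : trivIset setT V.
  move=> t t' _ _ [x [xt xt']]; apply/eqP/negPn/negP => /vdis[i [p [pK hp]]].
  have [m [mK /allowedP/(_ p pK) vm mx]] := (grid_setP _ _ _ _).1 (xt i).
  have [m' [m'K /allowedP/(_ p pK) vm' m'x]] := (grid_setP _ _ _ _).1 (xt' i).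
  have mm' := grid_cell_inj h0 mx m'x; rewrite -mm' in vm'.
  by have := hp (bit p m); rewrite vm vm'.
have := wt (\1_E : _ -> R) (2 ^- k.+1); rewrite invr_gt0 p0 => /(_ _ isT).
have mind : measurable_fun [set: Rn R N] (\1_E : _ -> R) by exact: measurable_indic.
move=> /(_ mind).
have -> : (\int[lebesgue N]_x (phi (`|\1_E x| / 2 ^- k.+1))%:E =
    (phi (2 ^+ k.+1) * (2 ^- (k + k) * X))%:E)%E.
  by rewrite integral_phi_indic ?invrK// lE EFinM.
move=> wtE.
have Vsub : \big[setU/set0]_(j < #|I|) V (enum_val j) `<=`
    [set x | ((2 ^- k.+1)%:E < maximal B (\1_E : _ -> R) x)%E].
  move=> x; rewrite -bigcup_seq => -[j _]; move: (enum_val j) => t.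
  exact: (digit_box_average h0 (bK t) (hr t) (rk t) (vw t) (hB t)).
have := le_trans (le_lebesgue Vsub) wtE.
rewrite (measure_bigsetU_ord _ xpredT)//; last first.
  by move=> j j' _ _ jj'; apply/enum_val_inj/disV.
rewrite (eq_bigr (fun j => (2 ^- (\sum_i s (enum_val j) i)%N * X)%:E));
  last by move=> j _; exact: lV.
rewrite sumEFin -EFinM lee_fin => main.
have : #|I|%:R * (2 ^- (k + l) * X) <= C * (phi (2 ^+ k.+1) * (2 ^- (k + k) * X)).
  apply: le_trans main; rewrite mulr_natl -[in leLHS](card_ord #|I|) -sumr_const.
  apply: ler_sum => j _.
  by rewrite ler_pM2r// lef_pV2 ?posrE// ler_weXn2l// ler1n.
have -> : #|I|%:R * (2 ^- (k + l) * X) = #|I|%:R * 2 ^+ k * (2 ^- (k + k) * 2 ^- l * X).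
  by rewrite !exprD; field; rewrite !gt_eqF.
have -> : C * (phi (2 ^+ k.+1) * (2 ^- (k + k) * X)) =
    2 ^+ l * C * phi (2 ^+ k.+1) * (2 ^- (k + k) * 2 ^- l * X).
  by rewrite !exprD; field; rewrite !gt_eqF.
by rewrite ler_pM2r// !mulr_gt0// invr_gt0.
Qed.

(** * Sparse exponents and patterns of digits *)

Lemma infinite_int_unbounded (G : set int) : infinite_set G ->
  (forall x, exists2 g, G g & x < g) \/ (forall x, exists2 g, G g & g < x).
Proof.
move=> Ginf; apply: contrapT => /not_orP[/existsNP[x hx] /existsNP[y hy]]; apply: Ginf.
apply: (@sub_finite_set _ _ ((fun i : nat => y + i%:Z) @` `I_(absz (x - y)).+1)).
  move=> g Gg.
  have gx : g <= x by rewrite leNgt; apply/negP => xg; apply: hx; exists g.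
  have yg : y <= g by rewrite leNgt; apply/negP => gy; apply: hy; exists g.
  by exists (absz (g - y)) => /=; lia.
by apply: finite_image; exact: finite_II.
Qed.

(** If [G] is only unbounded below, the terms are chosen downwards, starting
    with [c k]: this is why only the first [k] gaps are required. *)
Lemma sparse_sequence (G : set int) (W : int) k : infinite_set G -> 0 <= W ->
  exists c : nat -> int, (forall l, G (c l)) /\
    (forall l, (l < k)%N -> c l + W < c l.+1).
Proof.
move=> /infinite_int_unbounded[] hG W0.
  have /choice[f hf] : forall x, exists g, G g /\ x < g.
    by move=> x; have [g] := hG x; exists g.
  exists (fun l => iter l (fun y => f (y + W)) (f 0)).
  split=> [[|l]|l _] /=; first exact: (hf _).1.
    exact: (hf _).1.
  exact: (hf _).2.
have /choice[f hf] : forall x, exists g, G g /\ g < x.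
  by move=> x; have [g] := hG x; exists g.
exists (fun l => iter (k - l) (fun y => f (y - W)) (f 0)).
split=> [l|l lk]; first by case: (k - l)%N => [|m]; exact: (hf _).1.
by rewrite -subSS subSn//= -ltrBrDr; exact: (hf _).2.
Qed.

Section last_coordinate.
Context {X : Type} {n : nat}.

(** Families indexed by the coordinates of R^(n+1): [f] for the first [n] ones
    and [x] for the last. *)
Definition extend (f : 'I_n -> X) (x : X) (i : 'I_n.+1) : X :=
  if unlift ord_max i is Some j then f j else x.

Lemma lower_lift (i : 'I_n) : lower i = lift ord_max i.
Proof. by apply/val_inj; rewrite [RHS]lift_max. Qed.

Lemma extend_lower f x i : extend f x (lower i) = f i.
Proof. by rewrite /extend lower_lift liftK. Qed.

Lemma extend_max f x : extend f x ord_max = x.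
Proof. by rewrite /extend unlift_none. Qed.

Lemma lower_max_ind (P : 'I_n.+1 -> Prop) :
  (forall i, P (lower i)) -> P ord_max -> forall i, P i.
Proof.
by move=> Pl Pm i; case: (unliftP ord_max i) => [j|] ->//; rewrite -lower_lift.
Qed.

End last_coordinate.

Lemma sum_extend n (f : 'I_n -> nat) x :
  (\sum_i extend f x i = \sum_i f i + x)%N.
Proof.
rewrite big_ord_recr /= extend_max; congr addn.
by apply: eq_bigr => i _; exact: extend_lower.
Qed.

Section zero_digits.
Local Open Scope nat_scope.
Variables (f : nat -> nat) (Q : nat).
Hypothesis f_mono : forall l l', l <= Q -> l' <= Q -> (f l < f l') = (l < l').

Definition zero_digits (D : seq nat) (p : nat) (c : bool) := (p \in D) ==> ~~ c.

Lemma position_inj l l' : l <= Q -> l' <= Q -> f l = f l' -> l = l'.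
Proof.
move=> lQ l'Q E; have := f_mono lQ l'Q; have := f_mono l'Q lQ.
by rewrite E ltnn => /esym/negbT h1 /esym/negbT h2; lia.
Qed.

Lemma uniq_positions m k : m + k <= Q.+1 -> uniq [seq f l | l <- iota m k].
Proof.
move=> mkQ; rewrite map_inj_in_uniq ?iota_uniq// => l l'.
by rewrite !mem_iota => h h'; apply: position_inj; lia.
Qed.

Lemma zero_digits_sum D p :
  zero_digits D p false + zero_digits D p true = if p \in D then 1 else 2.
Proof. by rewrite /zero_digits; case: (p \in D). Qed.

Lemma choices_zero_digits m k b j : m + k <= Q.+1 -> j <= k ->
  (forall l, m <= l < m + k -> (f l < b) = (l < m + j)) ->
  2 ^ j * choices (zero_digits [seq f l | l <- iota m k]) b = 2 ^ b.
Proof.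
move=> mkQ jk hb.
have := @choices_constraints _ _ b (uniq_positions mkQ) (zero_digits_sum _).
rewrite count_map (eq_in_count (a2 := fun l => l < m + j)).
  by rewrite -size_filter filter_iota_ltn// size_iota.
by move=> l; rewrite mem_iota /=; exact: hb.
Qed.

(** The digits at the positions [f l] vanish for [t <= l < q] and, if [0 < t],
    the digit at [f t.-1] is 1: the last nonzero digit determines [t], whence
    [level_digits_disjoint]. *)
Definition level_digits q t (p : nat) (c : bool) :=
  zero_digits [seq f l | l <- iota t (q - t)] p c &&
  ((0 < t) && (p == f t.-1) ==> c).

(** The constrained positions are [f l] for [t.-1 <= l < q], whether or not
    [t = 0]. *)
Lemma choices_level_digits q t K : q <= Q -> t <= q ->
  (forall l, l <= Q -> f l < K) ->
  2 ^ (q - t.-1) * choices (level_digits q t) K = 2 ^ K.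
Proof.
move=> qQ tq fK.
have mQ : t.-1 + (q - t.-1) <= Q.+1 by lia.
rewrite -[RHS](@choices_constraints (level_digits q t) _ K (uniq_positions mQ)).
  congr (2 ^ _ * _); rewrite count_map.
  rewrite (eq_in_count (a2 := predT)) ?count_predT ?size_iota// => l.
  by rewrite mem_iota => h; apply: fK; lia.
move=> p; rewrite /level_digits /zero_digits.
case: t tq mQ => [|t] tq mQ /=; first by case: (p \in _).
have -> : iota t (q - t) = t :: iota t.+1 (q - t.+1).
  by rewrite -[q - t](@subnSK t q).
rewrite /= inE; case: eqVneq => [->|_] /=; last by case: (p \in _).
rewrite (_ : (f t \in _) = false)//; apply/negP => /mapP[l].
by rewrite mem_iota => h /position_inj; lia.
Qed.

Lemma level_digits_sub q t p c : f t <= p -> q <= Q -> t <= q ->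
  level_digits q t p c -> zero_digits [seq f l | l <- iota 0 q] p c.
Proof.
move=> fp qQ tq /andP[/implyP z _]; apply/implyP => /mapP[l].
rewrite mem_iota => lq E; apply: z; apply/mapP; exists l => //.
rewrite mem_iota; suff : ~~ (l < t) by lia.
by rewrite -f_mono; lia.
Qed.

Lemma level_digits_disjoint q t t' : t < t' <= q ->
  forall c, ~~ (level_digits q t (f t'.-1) c && level_digits q t' (f t'.-1) c).
Proof.
move=> tt' c; apply/negP => /andP[/andP[/implyP z _] /andP[_ /implyP o]].
have c1 : c by apply: o; rewrite eqxx andbT; lia.
have := z; rewrite c1 => h; suff : false by []; apply: h.
by apply/mapP; exists t'.-1 => //; rewrite mem_iota; lia.
Qed.

End zero_digits.

(** * The lower bound for the Orlicz function *)

Lemma sparse_mono (c : nat -> int) (W : int) k : 0 <= W ->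
  (forall l, (l < k)%N -> c l + W < c l.+1) ->
  forall l l', (l < l' <= k)%N -> c l + W < c l'.
Proof.
move=> W0 hc l; elim=> [|l' IH]; first by rewrite ltn0.
rewrite ltnS leq_eqVlt => /andP[/orP[/eqP <-|ll'] l'k]; first exact: hc.
by have := IH; rewrite ll' (ltnW l'k) => /(_ isT); have := hc l' l'k; lia.
Qed.

Lemma shifted_position_mono (c : nat -> int) (s : int) k :
  (forall l, (l < k)%N -> c l + 0 < c l.+1) ->
  (forall l, (l <= k)%N -> 0 <= c l + s) ->
  forall l l', (l <= k)%N -> (l' <= k)%N ->
    (absz (c l + s)%R < absz (c l' + s)%R)%N = (l < l')%N.
Proof.
move=> hc hs l l' lk l'k; have := hs l lk; have := hs l' l'k.
have [ll'|l'l|->] := ltngtP l l'; last by rewrite ltnn.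
- by have := sparse_mono (lexx 0) hc (l := l) (l' := l'); rewrite ll' l'k => /(_ isT); lia.
- by have := sparse_mono (lexx 0) hc (l := l') (l' := l); rewrite l'l lk => /(_ isT); lia.
Qed.

(** The exponents [a i l] of the first [n] sides and [g l + lam t] of the last
    one, the shift [lam t] being bounded by [Lam]. The gaps of [g] exceed
    [2 * Lam], so [g l + Lam] separates the last sides that belong to indices
    up to [l] from those that belong to larger ones. *)
Section sharpness.
Context {R : realType}.
Variables (n q : nat).
Let k := (n * q)%N.
Variables (a : 'I_n -> nat -> int) (g : nat -> int).
Variables (lam : {ffun 'I_n -> 'I_q.+1} -> int) (Lam : nat).
Hypothesis a_mono : forall i l, (l < q)%N -> a i l + 0 < a i l.+1.
Hypothesis g_sparse : forall l, (l < k)%N -> g l + (2 * Lam)%:Z < g l.+1.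
Hypothesis lam_le : forall t, (absz (lam t) <= Lam)%N.

Definition level (t : {ffun 'I_n -> 'I_q.+1}) : nat := (\sum_i t i)%N.

(** The larger the sides of the first coordinates, the smaller the last one:
    [k] digits are averaged in all. *)
Definition side (t : {ffun 'I_n -> 'I_q.+1}) : 'I_n.+1 -> int :=
  extend (fun i => a i (t i)) (g (k - level t) + lam t).

Lemma level_le t : (level t <= k)%N.
Proof.
rewrite /level /k -[X in (_ <= X * _)%N](card_ord n) -sum_nat_const.
by apply: leq_sum => i _; rewrite -ltnS.
Qed.

Lemma sharpness_bound (B : set (set (Rn R n.+1))) (phi : R -> R) (C : R) :
  (forall t (c : 'I_n.+1 -> nat),
     B (half_open_box (fun i => (c i)%:R * 2 ^ side t i)
                      (fun i => (c i).+1%:R * 2 ^ side t i))) ->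
  phi 0 = 0 -> 0 <= phi (2 ^+ k.+1) -> weak_type_estimate B phi C ->
  q.+1%:R ^+ n * 2 ^+ k <= 2 ^+ n * C * phi (2 ^+ k.+1).
Proof.
move=> hB phi0 phige0 wt.
(* All exponents become natural numbers after a shift by [L], that is, in the
   grid of mesh [2 ^- L]. *)
have [L [aL gL]] : exists L : nat,
    (forall i l, (l <= q)%N -> (absz (a i l) + Lam <= L)%N) /\
    (forall l, (l <= k)%N -> (absz (g l) + Lam <= L)%N).
  exists (\max_i \max_(l < q.+1) absz (a i l) + \max_(l < k.+1) absz (g l) + Lam)%N.
  split=> [i l lq|l lk]; rewrite leq_add2r.
    apply: leq_trans (leq_addr _ _).
    apply: leq_trans (leq_bigmax (F := fun i => \max_(l < q.+1) absz (a i l)) i).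
    exact: (leq_bigmax (F := fun l : 'I_q.+1 => absz (a i l))
      (Ordinal (lq : l < q.+1)%N)).
  apply: leq_trans (leq_addl _ _).
  exact: (leq_bigmax (F := fun l : 'I_k.+1 => absz (g l))
    (Ordinal (lk : l < k.+1)%N)).
pose K := (2 * L).+1.
pose A i l := absz (a i l + L%:Z).
pose D l := absz (g l + (Lam + L)%N%:Z).
have g_mono l : (l < k)%N -> g l + 0 < g l.+1.
  by move=> lk; have := g_sparse lk; lia.
have Amono i l l' : (l <= q)%N -> (l' <= q)%N -> (A i l < A i l')%N = (l < l')%N.
  apply: shifted_position_mono; first exact: a_mono.
  by move=> m mq; have := aL i m mq; lia.
have Dmono l l' : (l <= k)%N -> (l' <= k)%N -> (D l < D l')%N = (l < l')%N.
  apply: shifted_position_mono; first exact: g_mono.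
  by move=> m mk; have := gL m mk; lia.
have AK i l : (l <= q)%N -> (A i l < K)%N.
  by move=> lq; have := aL i l lq; rewrite /A /K; lia.
have DK l : (l <= k)%N -> (D l < K)%N.
  by move=> lk; have := gL l lk; rewrite /D /K; lia.
pose b t i := absz (side t i + L%:Z).
have b_lower t i : b t (lower i) = A i (t i) by rewrite /b /side extend_lower.
have side_ge t i : 0 <= side t i + L%:Z.
  move: i; apply: lower_max_ind => [i|]; rewrite /side ?extend_lower ?extend_max.
    by have := aL i (t i); rewrite -ltnS ltn_ord => /(_ isT); lia.
  by have := gL _ (leq_subr (level t) k); have := lam_le t; lia.
have bK t i : (b t i <= K)%N.
  move: i; apply: lower_max_ind => [i|].
    by rewrite b_lower ltnW// AK// -ltnS ltn_ord.
  rewrite /b /side extend_max /K.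
  by have := gL _ (leq_subr (level t) k); have := lam_le t; lia.
have Db t l : (l < k)%N -> (D l < b t ord_max)%N = (l < k - level t)%N.
  move=> lk; have := side_ge t ord_max; rewrite /b /D /side extend_max.
  have := gL l (ltnW lk); have := lam_le t.
  have [lt|tl] := ltnP l (k - level t).
    have := sparse_mono (W := (2 * Lam)%:Z) isT g_sparse (l := l) (l' := (k - level t)%N).
    by rewrite lt leq_subr => /(_ isT); lia.
  have [->|lt] := eqVneq l (k - level t)%N; first lia.
  have := sparse_mono (W := (2 * Lam)%:Z) isT g_sparse (l := (k - level t)%N) (l' := l).
  rewrite ltn_neqAle eq_sym lt tl (ltnW lk) => /(_ isT); lia.
pose w := extend (fun i => zero_digits [seq A i l | l <- iota 0 q])
                 (zero_digits [seq D l | l <- iota 0 k]).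
pose v (t : {ffun 'I_n -> 'I_q.+1}) := extend (fun i => level_digits (A i) q (t i))
                   (zero_digits [seq D l | l <- iota (k - level t) (level t)]).
have tq (t : {ffun 'I_n -> 'I_q.+1}) i : (t i <= q)%N by rewrite -ltnS ltn_ord.
(* In the last coordinate, [k - level t] of the [k] digit positions lie below
   the side [b t ord_max], by [Db]. *)
have := @digit_lower_bound R n.+1 _ K k n w v b
  (fun t : {ffun 'I_n -> 'I_q.+1} => extend (fun i => t i : nat) (k - level t)%N)
  (fun t : {ffun 'I_n -> 'I_q.+1} => extend (fun i => q - (t i).-1)%N (level t))
  (extend (fun=> q) k) (2 ^- L) B phi C.
rewrite card_ffun !card_ord natrX; apply=> //.
- move=> t; apply: lower_max_ind => [i|].
    rewrite b_lower /w !extend_lower.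
    by apply: (choices_zero_digits (Amono i)) => // l lq; rewrite Amono//; lia.
  rewrite /w !extend_max; apply: (choices_zero_digits Dmono); rewrite ?leq_subr//.
  by move=> l lk; rewrite Db.
- by move=> t; rewrite sum_extend subnKC// level_le.
- move=> t; apply: lower_max_ind => [i|].
    rewrite /v !extend_lower; apply: (choices_level_digits (Amono i)) => //.
    by move=> l lq; exact: AK.
  have lek := level_le t.
  rewrite /v !extend_max; apply: (choices_zero_digits Dmono) => //; first lia.
  by move=> l lk; rewrite DK; lia.
- move=> t; rewrite sum_extend.
  have -> : (k + n = \sum_(i < n) (q + 1))%N.
    by rewrite sum_nat_const card_ord mulnDr muln1.
  rewrite /level -big_split /=.
  by apply: leq_sum => i _; have := tq t i; lia.
- apply: lower_max_ind => [i|].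
    rewrite /w !extend_lower.
    by apply: (choices_zero_digits (Amono i)) => // l lq; rewrite AK; lia.
  rewrite /w !extend_max; apply: (choices_zero_digits Dmono) => // l lk.
  by rewrite DK; lia.
- by rewrite sum_extend sum_nat_const card_ord.
- move=> t i p c; move: i; apply: lower_max_ind => [i|].
    rewrite b_lower /v /w !extend_lower => h.
    exact: (level_digits_sub (Amono i) h).
  rewrite /v /w !extend_max => bp /implyP z; apply/implyP => /mapP[l].
  rewrite mem_iota => lk E; apply: z; apply/mapP; exists l => //.
  rewrite mem_iota; have := Db t l; rewrite -E => /(_ lk).
  by rewrite [(p < _)%N]ltnNge bp /=; have := level_le t; lia.
- move=> t t' tt'.
  have [i ti] : exists i, t i != t' i.
    apply/existsP; rewrite -negb_forall; apply: contra tt' => /forallP h.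
    by apply/eqP/ffunP => i; exact/eqP/h.
  exists (lower i); rewrite /v !extend_lower.
  have [lt|lt|/val_inj/eqP] := ltngtP (t i) (t' i); last by rewrite (negbTE ti).
    exists (A i (t' i).-1); split; first exact: AK (leq_trans (leq_pred _) (tq t' i)).
    have tt'q : (t i < t' i <= q)%N by rewrite lt tq.
    exact: (level_digits_disjoint (A i) tt'q).
  exists (A i (t i).-1); split; first exact: AK (leq_trans (leq_pred _) (tq t i)).
  move=> c; rewrite andbC; move: c.
  have t'tq : (t' i < t i <= q)%N by rewrite lt tq.
  exact: (level_digits_disjoint (A i) t'tq).
- move=> t c; have := hB t c; congr (B (half_open_box _ _)); apply/funext => i.
    rewrite natrM -mulrA; congr (_ * _).
    have -> : side t i = (b t i)%:Z - L%:Z by rewrite /b; have := side_ge t i; lia.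
    by rewrite expfzDr ?pnatr_eq0// exprnN -exprnP natrX.
  rewrite natrM -mulrA; congr (_ * _).
  have -> : side t i = (b t i)%:Z - L%:Z by rewrite /b; have := side_ge t i; lia.
  by rewrite expfzDr ?pnatr_eq0// exprnN -exprnP natrX.
Qed.

End sharpness.

(** * The two bases *)

Section bases.
Context {R : realType}.

(** At [u = 2 ^+ (n * q).+1] the product [u * (1 + log2 u) ^+ n] is at most
    [2 * 2 ^+ (n * q) * (2 * n * q.+1) ^+ n], so the lower bound makes the
    quotient of the limit stay away from 0. *)
Lemma little_o_contradiction n (phi : R -> R) (C : R) : (0 < n)%N ->
  (forall u, 0 <= u -> 0 <= phi u) ->
  phi u / (u * (1 + log2 u) ^+ n) @[u --> +oo] --> (0 : R) ->
  ~ forall q, q.+1%:R ^+ n * 2 ^+ (n * q) <=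
              2 ^+ n * C * phi (2 ^+ (n * q).+1).
Proof.
move=> n0 phige0 lim0 lower.
have e0 j : (0 : R) < 2 ^+ j by rewrite exprn_gt0.
pose c : R := 2 ^+ n * (`|C| + 1) * 2 * (2 * n%:R) ^+ n.
have n0R : (0 : R) < n%:R by rewrite ltr0n.
have c0 : 0 < c by rewrite !mulr_gt0 ?exprn_gt0 ?mulr_gt0// ltr_wpDl.
have ci0 : 0 < c^-1 by rewrite invr_gt0.
have /cvgr0Pnorm_lt/(_ _ ci0)[M [_ hM]] := lim0.
pose q := (Num.truncn (`|M|)).+1.
pose k := (n * q)%N.
have Mu : M < 2 ^+ k.+1.
  apply: (le_lt_trans (ler_norm M)); apply: (@lt_trans _ _ q%:R).
    by rewrite /q truncnS_gt.
  rewrite -natrX ltr_nat (leq_ltn_trans _ (ltn_expl _ _))// /k.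
  by rewrite (leq_trans (leq_pmull q n0)).
have := hM _ Mu; have := phige0 _ (ltW (e0 k.+1)); have := lower q.
rewrite log2_exp2; set p := phi _ => low p0.
have l0 : (0 : R) < 2 ^+ k.+1 * (1 + k.+1%:R) ^+ n.
  by rewrite mulr_gt0// exprn_gt0// ltr_pwDl.
rewrite /= ger0_norm; last by rewrite divr_ge0// ltW.
rewrite ltr_pdivrMr// => pc.
have : p * (2 ^+ n * (`|C| + 1)) < q.+1%:R ^+ n * 2 ^+ k.
  apply: (@lt_le_trans _ _ (c^-1 * (2 ^+ k.+1 * (1 + k.+1%:R) ^+ n) * (2 ^+ n * (`|C| + 1)))).
    by rewrite ltr_pM2r// mulr_gt0// ltr_wpDl.
  have kq : (1 + k.+1%:R) ^+ n <= (2 * n%:R) ^+ n * q.+1%:R ^+ n :> R.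
    have h : 1 + k.+1%:R <= 2 * n%:R * q.+1%:R :> R.
      by rewrite -!natrM -(natrD _ 1) ler_nat /k; nia.
    rewrite -exprMn; apply: lerXn2r h; rewrite nnegrE; first exact: addr_ge0.
    by rewrite !mulr_ge0.
  have -> : q.+1%:R ^+ n * 2 ^+ k = c^-1 * (2 ^+ k.+1 *
      ((2 * n%:R) ^+ n * q.+1%:R ^+ n)) * (2 ^+ n * (`|C| + 1)).
    rewrite /c exprS; field.
    by rewrite !gt_eqF ?exprn_gt0 ?mulr_gt0// ltr_wpDl.
  rewrite ler_pM2r; last by rewrite mulr_gt0// ltr_wpDl.
  by rewrite !ler_pM2l.
rewrite ltNge => /negP; apply; apply: (le_trans low).
rewrite [leRHS]mulrC ler_wpM2r// ler_pM2l// (le_trans (ler_norm C))//.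
by rewrite lerDl.
Qed.

Definition dyadic_side (s : int) (c : nat) : set R :=
  `[c%:R * 2 ^ s, c.+1%:R * 2 ^ s[%classic.

Lemma lebesgue_dyadic_side s c : lebesgue_measure (dyadic_side s c) = (2 ^ s)%:E.
Proof.
have s0 : (0 : R) < 2 ^ s by rewrite exprz_gt0.
rewrite lebesgue_measure_itv /= lte_fin ltr_pM2r// ltr_nat ltnSn -EFinB.
by rewrite -natr1; congr EFin; ring.
Qed.

Lemma len_dyadic_side s c : len (dyadic_side s c) = 2 ^ s.
Proof. by rewrite /len lebesgue_dyadic_side. Qed.

Lemma interval_dyadic_sides N (s : 'I_N -> int) (c : 'I_N -> nat) :
  interval_sides (fun i => dyadic_side (s i) (c i)).
Proof.
move=> i; split; first exact: interval_is_interval.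
by rewrite lebesgue_dyadic_side ltry lte_fin exprz_gt0.
Qed.

(** What a basis needs for sharpness: the last exponent can be moved along
    [G] while the others are prescribed in the [T i]. The shift [lam] is
    arbitrary, whence a common treatment of products and quotients. *)
Theorem sharp_weak_type_criterion n (C : R) (T : 'I_n -> set R) (G : set int)
    (lam : ('I_n -> int) -> int) (B : set (set (Rn R n.+1))) :
  (0 < n)%N ->
  weak_type_estimate B (fun u => u * (1 + logp u) ^+ n) C ->
  (forall i, T i `<=` dyadic) -> (forall i, infinite_set (T i)) ->
  infinite_set G ->
  (forall (s : 'I_n -> int) g (c : 'I_n.+1 -> nat),
    (forall i, T i (2 ^ s i)) -> G g ->
    B (box (fun i => dyadic_side (extend s (g + lam s) i) (c i)))) ->
  sharp_weak_type C B.
Proof.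
move=> n0 wt Tdyadic Tinf Ginf hB; split=> // phi phige0 phi0 _ _ lim0 [C' wt'].
apply: (@little_o_contradiction n phi C' n0 _ lim0).
  by move=> u u0; apply: phige0; rewrite in_itv /= u0.
move=> q; pose k := (n * q)%N.
pose S i : set int := [set s | T i (2 ^ s)].
have Sinf i : infinite_set (S i).
  apply: contra_not (Tinf i) => Sfin.
  apply: (@sub_finite_set _ _ ((fun s : int => 2 ^ s) @` S i)).
    by move=> x Tx; have [s _ sx] := Tdyadic i x Tx; exists s => //; rewrite /S /= sx.
  exact: finite_image.
have /choice[a /all_and2[aS a_mono]] := fun i => sparse_sequence q (Sinf i) (lexx 0).
pose lam' (t : {ffun 'I_n -> 'I_q.+1}) := lam (fun i => a i (t i)).
pose Lam := (\max_t absz (lam' t))%N.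
have lam_le t : (absz (lam' t) <= Lam)%N by exact: (leq_bigmax (F := fun t => absz (lam' t))).
have [g [gG g_sparse]] := @sparse_sequence G (2 * Lam)%:Z k Ginf isT.
apply: (sharpness_bound a_mono g_sparse lam_le _ phi0 _ wt').
  by move=> t c; apply: hB => // i; exact: aS.
by apply: phige0; rewrite in_itv /= exprn_ge0.
Qed.

Lemma prod_exp2 p (s : 'I_p -> int) : \prod_i 2 ^ s i = 2 ^ (\sum_i s i) :> R.
Proof.
elim/big_rec2: _ => [|i y x _ ->]; first by rewrite expr0z.
by rewrite expfzDr ?pnatr_eq0.
Qed.

Lemma dyadic_exp2 s : @dyadic R (2 ^ s).
Proof. by exists s. Qed.

Lemma dyadic_sides_box n (T : 'I_n -> set R) (I : 'I_n.+1 -> set R) :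
  (forall i, T i `<=` dyadic) -> interval_sides I ->
  (forall i, T i (len (I (lower i)))) ->
  (forall s : 'I_n -> int, (forall i, len (I (lower i)) = 2 ^ s i) ->
    dyadic (len (I ord_max))) ->
  dyadic_box (box I).
Proof.
move=> Td sI TI last; exists I; split=> //.
have /choice[s sE] : forall i, exists s : int, len (I (lower i)) = 2 ^ s.
  by move=> i; have [s _ <-] := Td i _ (TI i); exists s.
apply: lower_max_ind => [i|]; first exact: Td (TI i).
exact: last sE.
Qed.

Lemma basis_div_dyadic n p (T : 'I_n -> set R) G (j : 'I_p -> 'I_n) :
  (forall i, T i `<=` dyadic) -> basis_div T G j `<=` @dyadic_box R n.+1.
Proof.
move=> Td Q [I [sI -> TI [g _ lI]]]; apply: (dyadic_sides_box Td sI TI) => s sE.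
rewrite lI (eq_bigr (fun k => 2 ^ s (j k))) => [|k _]; last by rewrite sE.
by rewrite prod_exp2 invr_expz -expfzDr ?pnatr_eq0//; exact: dyadic_exp2.
Qed.

Lemma basis_mul_dyadic n p (T : 'I_n -> set R) G (j : 'I_p -> 'I_n) :
  (forall i, T i `<=` dyadic) -> basis_mul T G j `<=` @dyadic_box R n.+1.
Proof.
move=> Td Q [I [sI -> TI [g _ lI]]]; apply: (dyadic_sides_box Td sI TI) => s sE.
rewrite lI (eq_bigr (fun k => 2 ^ s (j k))) => [|k _]; last by rewrite sE.
by rewrite prod_exp2 -expfzDr ?pnatr_eq0//; exact: dyadic_exp2.
Qed.

Lemma basis_div_box n p (T : 'I_n -> set R) G (j : 'I_p -> 'I_n)
    (s : 'I_n -> int) g (c : 'I_n.+1 -> nat) :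
  (forall i, T i (2 ^ s i)) -> G g ->
  basis_div T G j
    (box (fun i => dyadic_side (extend s (g - \sum_k s (j k)) i) (c i))).
Proof.
move=> Ts Gg.
exists (fun i => dyadic_side (extend s (g - \sum_k s (j k)) i) (c i)).
split=> //; first exact: interval_dyadic_sides.
  by move=> i; rewrite len_dyadic_side extend_lower.
exists g => //; rewrite len_dyadic_side extend_max.
transitivity (2 ^ g / \prod_(k < p) 2 ^ s (j k) : R).
  by rewrite prod_exp2 invr_expz -expfzDr ?pnatr_eq0.
congr (_ / _); apply: eq_bigr => k _.
by rewrite len_dyadic_side extend_lower.
Qed.

Lemma basis_mul_box n p (T : 'I_n -> set R) G (j : 'I_p -> 'I_n)
    (s : 'I_n -> int) g (c : 'I_n.+1 -> nat) :
  (forall i, T i (2 ^ s i)) -> G g ->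
  basis_mul T G j
    (box (fun i => dyadic_side (extend s (g + \sum_k s (j k)) i) (c i))).
Proof.
move=> Ts Gg.
exists (fun i => dyadic_side (extend s (g + \sum_k s (j k)) i) (c i)).
split=> //; first exact: interval_dyadic_sides.
  by move=> i; rewrite len_dyadic_side extend_lower.
exists g => //; rewrite len_dyadic_side extend_max.
transitivity (2 ^ g * \prod_(k < p) 2 ^ s (j k) : R).
  by rewrite prod_exp2 -expfzDr ?pnatr_eq0.
congr (_ * _); apply: eq_bigr => k _.
by rewrite len_dyadic_side extend_lower.
Qed.

End bases.

Theorem mainTheorem3 (R : realType) (n : nat) :
  exists Cn : R,
    forall (T : 'I_n -> set R) (G : set int) (p : nat) (j : 'I_p -> 'I_n),
      (forall i, T i `<=` dyadic) -> (forall i, infinite_set (T i)) ->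
      infinite_set G ->
      (1 <= p <= n)%N ->
      (forall k l : 'I_p, (k < l)%N -> (j k < j l)%N) ->
      sharp_weak_type Cn (basis_div T G j) /\
      sharp_weak_type Cn (basis_mul T G j).
Proof.
have [C weak] := dyadic_box_weak_type (R := R) n.
exists C => T G p j Td Tinf Ginf /andP[p1 pn] _.
have n0 : (0 < n)%N by exact: leq_trans pn.
split.
- apply: (@sharp_weak_type_criterion _ n C T G (fun s => - \sum_k s (j k))) => //.
    by apply: weak; exact: basis_div_dyadic.
  by move=> s g c; exact: basis_div_box.
- apply: (@sharp_weak_type_criterion _ n C T G (fun s => \sum_k s (j k))) => //.
    by apply: weak; exact: basis_mul_dyadic.
  by move=> s g c; exact: basis_mul_box.
Qed.
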